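(* Let $\mathcal A$ be a complex FC-complete continuous inverse algebra. Let $\mathfrak g$ be a complex Lie subalgebra of $\mathcal A$ and let $\mathcal A(\mathfrak g)$ be the closed unital associative subalgebra of $\mathcal A$ generated by $\mathfrak g$. Then for every finite-dimensional solvable ideal $\mathfrak j$ of $\mathfrak g$ we have $$[\mathfrak j,\mathfrak g]\subseteq\operatorname{rad}(\mathcal A(\mathfrak g))\subseteq\mathcal Q_{\mathcal A}.$$
   Context: A locally convex algebra is an associative algebra that is a locally convex space with continuous multiplication. For a unital algebra $\mathcal A$, $\mathcal A^\times$ denotes its group of invertible elements and $\mathbf 1$ its unit. A continuous inverse algebra (CIA) is a Hausdorff locally convex unital algebra $\mathcal A$ whose unit group $\mathcal A^\times$ is open and for which inversion $\mathcal A^\times\to\mathcal A$, $a\mapsto a^{-1}$, is continuous. Algebras are assumed nonzero, so spectra in complex CIAs are non-empty. For $a$ in a complex unital algebra $\mathcal A$, the spectrum is $\sigma_{\mathcal A}(a)=\{\lambda\in\mathbb C\mid\lambda\mathbf 1-a\notin\mathcal A^\times\}$ (compact when $\mathcal A$ is a complex CIA). A complex CIA $\mathcal A$ is FC-complete if for every $a\in\mathcal A$, every open neighborhood $U$ of $\sigma_{\mathcal A}(a)$ in $\mathbb C$, every holomorphic function $f$ on $U$ and every (piecewise smooth) contour $\Gamma$ around $\sigma_{\mathcal A}(a)$ in $U$, the integral $\frac{1}{2\pi i}\oint_\Gamma f(\zeta)(a-\zeta\mathbf 1)^{-1}\,d\zeta$, which a priori defines an element of the completion of $\mathcal A$, exists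 in $\mathcal A$. Notation: $\mathcal Q_{\mathcal A}=\{a\in\mathcal A\mid\sigma_{\mathcal A}(a)=\{0\}\}$; for a unital complex algebra $\mathcal B$, $\operatorname{rad}\mathcal B=\{a\in\mathcal B\mid\mathbf 1-ab\in\mathcal B^\times\text{ for all }b\in\mathcal B\}$ (the Jacobson radical). $\mathcal A$ is a Lie algebra under $[a,b]=ab-ba$; a complex Lie subalgebra is a complex linear subspace closed under this bracket (possibly infinite-dimensional). The ideal $\mathfrak j$ is an ideal of the Lie algebra $\mathfrak g$, and $[\mathfrak j,\mathfrak g]$ is the linear span of the brackets. *)

(* Defs.v *)
From HB Require Import structures.
From mathcomp Require Import all_boot all_order all_algebra.
From mathcomp Require Import complex.
From mathcomp Require Import all_classical all_reals all_analysis.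

Set Implicit Arguments.
Unset Strict Implicit.
Unset Printing Implicit Defensive.

Import Order.TTheory GRing.Theory Num.Theory.
Import numFieldTopology.Exports numFieldNormedType.Exports.

Local Open Scope classical_set_scope.
Local Open Scope ring_scope.
Local Open Scope complex_scope.

(* [tvsType] is MathComp-Analysis's locally convex space (not necessarily
   Hausdorff).  [GRing.inv] is the identity off the units; as the units are
   open, [inv_continuous] is continuity of inversion on the unit group. *)
HB.mixin Record isContinuousInverse A
    & Topological A & GRing.UnitRing A := {
  cia_hausdorff : hausdorff_space A ;
  mul_continuous : continuous (fun z : A * A => z.1 * z.2) ;
  open_unit : open [set x : A | x \is a GRing.unit] ;
  inv_continuous : forall x : A, x \is a GRing.unit ->
    {for x, continuous (@GRing.inv A)}
}.

#[short(type="ciaType")]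
HB.structure Definition ContinuousInverseAlgebra (K : numFieldType) :=
  {A of Tvs K A & GRing.UnitAlgebra K A & isContinuousInverse A}.

Section Integration.
Context {R : realType}.

Definition tagged_partition (d : R) (n : nat) (t xi : nat -> R) : Prop :=
  [/\ t 0 = 0, t n = 1 &
      forall k, (k < n)%N ->
        [/\ t k <= xi k, xi k <= t k.+1 & t k.+1 - t k < d]].

(* The integral over [0, 1] of a continuous [h] always exists in the completion
   of [E], as the limit of its Riemann sums; it exists in [E] if and only if the
   Riemann sums converge to some [y] in [E]. *)
Definition is_riemann_integral (E : tvsType R[i]) (h : R -> E) (y : E) : Prop :=
  forall V : set E, nbhs y V ->
    exists2 d : R, 0 < d &
      forall n t xi, tagged_partition d n t xi ->
        V (\sum_(k < n) (t k.+1 - t k)%:C *: h (xi k)).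

(* An arc is the restriction to [0, 1] of a C^oo function [R -> C]. *)
Definition smooth_arc (g : R -> R[i]) : Prop :=
  forall (n : nat) (t : R),
    derivable (derive1n n (@complex.Re R \o g)) t 1 /\
    derivable (derive1n n (@complex.Im R \o g)) t 1.

Definition arc_deriv (g : R -> R[i]) (t : R) : R[i] :=
  derive1 (@complex.Re R \o g) t +i* derive1 (@complex.Im R \o g) t.

(* A closed piecewise smooth curve is a cyclic sequence of smooth arcs, each
   starting where the previous one ends. *)
Definition closed_curve (c : seq (R -> R[i])) : Prop :=
  (forall i, (i < size c)%N -> smooth_arc (nth (fun=> 0) c i)) /\
  cycle (fun g h : R -> R[i] => g 1 == h 0) c.

(* The integral along a finite family of closed curves.  All arcs are
   parametrised by [0, 1], so the arcs are summed before integrating: the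
   integrals along the single arcs need not exist in [E], only their sum. *)
Definition is_contour_integral (E : tvsType R[i]) (G : seq (seq (R -> R[i])))
    (F : R[i] -> E) (y : E) : Prop :=
  is_riemann_integral
    (fun t => \sum_(g <- flatten G) arc_deriv g t *: F (g t)) y.

Definition two_pi_i : R[i] := 0 +i* (2 * pi).

Definition winding_number (G : seq (seq (R -> R[i]))) (z : R[i]) (m : int) :=
  is_contour_integral G (fun w => (w - z)^-1 : R[i]^o) (m%:~R * two_pi_i).

(* [G] is a contour around [K] in [U]: it runs in [U] off [K], and winds once
   around each point of [K] and zero times around each point outside [U]. *)
Definition contour_around (K U : set R[i]) (G : seq (seq (R -> R[i]))) : Prop :=
  [/\ forall i, (i < size G)%N -> closed_curve (nth [::] G i),
      forall i t, (i < size (flatten G))%N -> 0 <= t <= 1 ->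
        (U `\` K) (nth (fun=> 0) (flatten G) i t),
      forall z, K z -> winding_number G z 1 &
      forall z, ~ U z -> winding_number G z 0].

Definition holomorphic_on (U : set R[i]) (f : R[i] -> R[i]) : Prop :=
  forall z, U z -> derivable (f : R[i]^o -> R[i]^o) z 1.

End Integration.

Section Algebra.
Context {R : realType} {A : ciaType R[i]}.
Implicit Types (a x y : A) (X B g j : set A).

Definition spectrum a : set R[i] :=
  [set l | ~ (l%:A - a \is a GRing.unit)].

Definition quasinilpotents : set A := [set a | spectrum a = [set 0]].

Definition linear_subspace X : Prop :=
  X 0 /\ forall (c : R[i]) x y, X x -> X y -> X (c *: x + y).

Definition linear_span X : set A := smallest linear_subspace X.

Definition unital_subalgebra B : Prop :=
  [/\ linear_subspace B, B 1 & forall x y, B x -> B y -> B (x * y)].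

Definition closed_generated_algebra X : set A :=
  smallest [set B | unital_subalgebra B /\ closed B] X.

(* Invertibility and the Jacobson radical relative to a unital subalgebra [B]:
   the inverse has to lie in [B]. *)
Definition unit_in B x : Prop :=
  B x /\ exists2 y, B y & x * y = 1 /\ y * x = 1.

Definition jacobson_rad B : set A :=
  [set a | B a /\ forall b, B b -> unit_in B (1 - a * b)].

Definition lie x y : A := x * y - y * x.

Definition lie_bracket X Y : set A :=
  linear_span [set lie x y | x in X & y in Y].

Definition lie_subalgebra g : Prop :=
  linear_subspace g /\ forall x y, g x -> g y -> g (lie x y).

Definition lie_ideal g j : Prop :=
  [/\ linear_subspace j, j `<=` g & forall x y, j x -> g y -> j (lie x y)].

Definition finite_dimensional X : Prop :=
  exists s : seq A, X = linear_span [set` s].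

Definition derived_series j (n : nat) : set A :=
  iter n (fun X => lie_bracket X X) j.

Definition solvable_lie j : Prop :=
  exists n, derived_series j n = [set 0].

End Algebra.

Definition fc_complete (R : realType) (A : ciaType R[i]) : Prop :=
  forall (a : A) (U : set R[i]) (f : R[i] -> R[i]) (G : seq (seq (R -> R[i]))),
    open (U : set R[i]^o) -> spectrum a `<=` U -> holomorphic_on U f ->
    contour_around (spectrum a) U G ->
    exists y : A,
      is_contour_integral G (fun w => f w *: (a - w%:A)^-1) (two_pi_i *: y).

Arguments quasinilpotents {R} A.

(* Main.v *)
From Pilot Require Import Defs.
From HB Require Import structures.
From mathcomp Require Import all_boot all_order all_algebra.
From mathcomp Require Import complex.
From mathcomp Require Import all_classical all_reals all_analysis.
From mathcomp Require Import ring.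

(** Write [B] for the closed unital algebra generated by [g], [J] for its radical and
    [Q = B / J].  Two facts about continuous inverse algebras carry the analysis.

    - If [1 - l b] is invertible for all [|l| <= 2], then [b ^ n] tends to [0]
      ([powers_vanish]).  The mean of the resolvent [(1 - l b) ^ -1] over the [n]-th roots
      of unity is [(1 - b ^ n) ^ -1].  The resolvent is holomorphic and bounded on the
      unit disc, so by a discrete form of Cauchy's theorem this mean tends to the value
      [1] of the resolvent at the centre.
    - Hence the elements near [0] have powers tending to [0], and for such a [b] in [B] the
      Neumann series inverts [1 - b] inside [B]; so the invertible elements of [B] are a
      neighbourhood of [1] in [B], and [J] is closed ([vanishing_unit_in], [closed_rad]).
      Moreover the powers of any element grow at most exponentially
      ([powers_exp_bounded]).

    Call an element [c] of [Q] quasinilpotent if its powers lift to a sequence in [B]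
    that tends to [0] faster than every exponential.  Four statements about [Q] follow:
    a quasinilpotent element commuting with the image [G] of [g] is [0], because it is
    central and radical ([quasinil_central_eq0]); [[p, [p, q]] = 0] makes [[p, q]]
    quasinilpotent, by the Kleinecke-Shirokov computation
    [(ad p) ^ n (q ^ n) = n! [p, q] ^ n] ([quasinil_brk]); [ad q] has no eigenvalue of
    large modulus ([quot_brk_bounded]); and a [G]-stable subspace some power of which
    vanishes is [0] ([nil_ideal_eq0]).

    The rest is algebra.  By induction on the derived length, the image in [Q] of
    [[j, j]] is centralised by [G]; then Kleinecke-Shirokov shows that it is [0], that
    is, the image of [j] is abelian.  Let [n] be the span of the brackets of that image
    with [G]: it is finite-dimensional, commutative, and consists of quasinilpotents.
    Its nilpotent elements form a [G]-stable subspace, with vanishing powers by Engel,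
    hence [0].  If [[c, x] = mu c] with [mu <> 0], then [[c ^ k, x] = k mu c ^ k], so
    [c ^ k = 0] for large [k], and [c = 0].  So [G] acts on [n] by nilpotent operators
    and, by Engel again, a nonzero [n] would contain a nonzero [c] commuting with [G],
    which is impossible ([abelian_ideal_central]).

    For [a] in [J] all [1 - l a] are invertible, so [a ^ n] decays faster than every
    exponential; [a] is therefore not invertible, and its spectrum is [{0}]. *)

Set Implicit Arguments.
Unset Strict Implicit.
Unset Printing Implicit Defensive.

Import Order.TTheory GRing.Theory Num.Theory.
Import numFieldTopology.Exports numFieldNormedType.Exports.

Local Open Scope classical_set_scope.
Local Open Scope ring_scope.
Local Open Scope complex_scope.

(** * Finite-dimensional subspaces *)

Section Subspaces.
Variables (K : fieldType) (V : lmodType K).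
Implicit Types (X L : set V) (x y : V).

Definition subspace X : Prop :=
  X 0 /\ forall (c : K) x y, X x -> X y -> X (c *: x + y).

Lemma subspaceD X x y : subspace X -> X x -> X y -> X (x + y).
Proof. by move=> [_ h] hx hy; rewrite -[x]scale1r; apply: h. Qed.

Lemma subspaceZ X c x : subspace X -> X x -> X (c *: x).
Proof. by move=> [h0 h] hx; rewrite -[c *: x]addr0; apply: h. Qed.

Lemma subspaceB X x y : subspace X -> X x -> X y -> X (x - y).
Proof.
by move=> hX hx hy; apply: subspaceD => //; rewrite -scaleN1r; apply: subspaceZ.
Qed.

(** The linear combination of the family [e] with coefficient row [v]. *)
Definition comb d (e : 'I_d -> V) (v : 'rV[K]_d) : V := \sum_i v 0 i *: e i.

Lemma comb_linear d (e : 'I_d -> V) c u v :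
  comb e (c *: u + v) = c *: comb e u + comb e v.
Proof.
rewrite /comb scaler_sumr -big_split; apply: eq_bigr => i _ /=.
by rewrite !mxE scalerDl scalerA.
Qed.

Lemma comb0 d (e : 'I_d -> V) : comb e 0 = 0.
Proof. by rewrite /comb big1 // => i _; rewrite mxE scale0r. Qed.

Lemma combZ d (e : 'I_d -> V) c v : comb e (c *: v) = c *: comb e v.
Proof. by rewrite -[c *: v]addr0 comb_linear comb0 addr0. Qed.

Lemma comb_mulmx d m (e : 'I_d -> V) (f : 'I_m -> V) (M : 'M[K]_(d, m)) v :
  (forall i, e i = comb f (row i M)) -> comb e v = comb f (v *m M).
Proof.
move=> he; rewrite /comb (eq_bigr (fun i => \sum_j (v 0 i * M i j) *: f j)).
  rewrite exchange_big; apply: eq_bigr => j _ /=.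
  by rewrite mxE scaler_suml.
move=> i _; rewrite he /comb scaler_sumr; apply: eq_bigr => j _.
by rewrite mxE scalerA.
Qed.

Definition free_family d (e : 'I_d -> V) : Prop :=
  forall v, comb e v = 0 -> v = 0.

(** [L] is contained in the span of finitely many vectors; it need not contain them. *)
Definition fin_gen L : Prop :=
  exists m (s : 'I_m -> V), L `<=` range (comb s).

(** The sum of [X] and the line through [y]. *)
Definition adjoin X y : set V := [set z | exists2 x, X x & exists c, z = x + c *: y].

Lemma subspace_range d (e : 'I_d -> V) : subspace (range (comb e)).
Proof.
split; first by exists 0 => //; rewrite comb0.
by move=> c _ _ [u _ <-] [v _ <-]; exists (c *: u + v) => //; rewrite comb_linear.
Qed.

Lemma free_family_size d m (e : 'I_d -> V) (s : 'I_m -> V) :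
  free_family e -> (forall i, range (comb s) (e i)) -> (d <= m)%N.
Proof.
move=> fe se; have /choice[r hr] : forall i, exists v, comb s v = e i.
  by move=> i; case: (se i) => v _ <-; exists v.
pose M : 'M[K]_(d, m) := \matrix_(i, j) r i 0 j.
have hM i : e i = comb s (row i M).
  by rewrite -hr; congr comb; apply/rowP => j; rewrite !mxE.
rewrite leqNgt; apply/negP => ltmd.
have : kermx M != 0.
  rewrite -mxrank_eq0 mxrank_ker subn_eq0 -ltnNge.
  exact: leq_ltn_trans (rank_leq_col M) ltmd.
case/rowV0Pn => v /sub_kermxP vM /eqP; apply; apply: fe.
by rewrite (comb_mulmx _ hM) vM comb0.
Qed.

Lemma free_family_adjoin d (e : 'I_d -> V) y :
  free_family e -> ~ range (comb e) y ->
  exists e' : 'I_d.+1 -> V,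
    free_family e' /\ range (comb e') = adjoin (range (comb e)) y.
Proof.
move=> fe ye; pose e' i := if unlift ord0 i is Some j then e j else y.
have he' v : comb e' v = v 0 ord0 *: y + comb e (\row_j v 0 (lift ord0 j)).
  rewrite /comb big_ord_recl /e' unlift_none; congr (_ + _).
  by apply: eq_bigr => i _; rewrite liftK mxE.
exists e'; split.
  move=> v; rewrite he' => h.
  have v0 : v 0 ord0 = 0.
    apply/eqP/negP => /negP nz; apply: ye.
    exists (- (v 0 ord0)^-1 *: (\row_j v 0 (lift ord0 j))) => //.
    rewrite combZ; move/eqP: h; rewrite addr_eq0 => /eqP h.
    by rewrite scaleNr -scalerN -h scalerA mulVf ?scale1r.
  move: h; rewrite v0 scale0r add0r => /fe /rowP h.
  apply/rowP => i; rewrite mxE; case: (unliftP ord0 i) => [j|] -> //.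
  by have := h j; rewrite !mxE.
apply/seteqP; split=> z.
  move=> [v _ <-]; rewrite he'; exists (comb e (\row_j v 0 (lift ord0 j))).
    by exists (\row_j v 0 (lift ord0 j)).
  by exists (v 0 ord0); rewrite addrC.
move=> [_ [u _ <-] [c ->]].
exists (\row_i if unlift ord0 i is Some j then u 0 j else c) => //.
rewrite he' mxE unlift_none addrC; congr (comb _ _ + _).
by apply/rowP => j; rewrite !mxE liftK.
Qed.

(** Induction on dimension: a property that holds for zero and can be passed on from any
    proper subspace of [L] to one of dimension one more holds for [L]. *)
Lemma fin_gen_rect L (P : set V -> Prop) :
  subspace L -> fin_gen L -> P [set 0] ->
  (forall X, subspace X -> X `<=` L -> P X -> ~ (L `<=` X) ->
     exists y, [/\ L y, ~ X y & P (adjoin X y)]) ->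
  P L.
Proof.
move=> sL [m [s hs]] P0 hP.
suff H k d (e : 'I_d -> V) : (d + k = m.+1)%N -> free_family e ->
    range (comb e) `<=` L -> P (range (comb e)) -> P L.
  apply: (H m.+1 0%N (fun=> 0)) => //.
  - by move=> v _; apply/rowP; case.
  - by move=> _ [v _ <-]; rewrite /comb big_ord0; case: sL.
  - suff -> : range (comb (fun _ : 'I_0 => 0)) = [set 0] by [].
    apply/seteqP; split=> z; first by move=> [v _ <-]; rewrite /comb big_ord0.
    by move=> ->; exists 0 => //; rewrite comb0.
elim: k d e => [|k IH] d e dk fe eL Pe.
  have /(free_family_size fe) : forall i, range (comb s) (e i).
    move=> i; apply/hs/eL; exists (delta_mx 0 i) => //.
    rewrite /comb (bigD1 i) //= mxE !eqxx scale1r big1 ?addr0 // => j ji.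
    by rewrite mxE (negbTE ji) andbF scale0r.
  by rewrite -ltnS -dk addn0 ltnn.
have [Le|nLe] := pselect (L `<=` range (comb e)).
  by suff <- : range (comb e) = L by []; apply/seteqP.
have [y [Ly ye Py]] := hP _ (subspace_range e) eL Pe nLe.
have [e' [fe' re']] := free_family_adjoin fe ye.
apply: (IH _ e'); rewrite ?re' ?addSnnS //.
move=> _ [x hx [c ->]]; apply: subspaceD => //; first exact: eL.
exact: subspaceZ.
Qed.

Lemma exists_basis L : subspace L -> fin_gen L ->
  exists d (e : 'I_d -> V), free_family e /\ range (comb e) = L.
Proof.
move=> sL fL.
apply: (@fin_gen_rect L (fun X => exists d (e : 'I_d -> V),
  free_family e /\ range (comb e) = X)) => //.
  exists 0%N, (fun=> 0); split; first by move=> v _; apply/rowP; case.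
  apply/seteqP; split=> z; first by move=> [v _ <-]; rewrite /comb big_ord0.
  by move=> ->; exists 0 => //; rewrite comb0.
move=> X sX XL [d [e [fe eX]]] nLX.
have [y Ly Xy] : exists2 y, L y & ~ X y.
  by move/existsNP: nLX => [y /not_implyP[]]; exists y.
exists y; split=> //; have [] := @free_family_adjoin d e y fe; first by rewrite eX.
by move=> e' [fe' re']; exists d.+1, e'; split=> //; rewrite re' eX.
Qed.

(** The linear span, as the intersection of the subspaces containing [X]. *)
Definition lspan X : set V := [set v | forall Y, subspace Y -> X `<=` Y -> Y v].

Lemma subspace_lspan X : subspace (lspan X).
Proof.
split=> [Y [Y0 _] //|c x y hx hy Y sY XY].
by case: (sY) => _; apply; [exact: hx|exact: hy].
Qed.

Lemma sub_lspan X : X `<=` lspan X. Proof. by move=> x Xx Y _; apply. Qed.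

End Subspaces.

(** * Engel's theorem in an associative algebra *)

Section Engel.
Variables (K : fieldType) (Q : algType K).
Implicit Types (H L : set Q) (u x y h : Q).

(** The commutator, in an arbitrary algebra. *)
Definition brk x y : Q := x * y - y * x.

Lemma brkN x y : brk x y = - brk y x. Proof. by rewrite /brk opprB. Qed.

Lemma brk_linear c x x' y : brk (c *: x + x') y = c *: brk x y + brk x' y.
Proof.
by rewrite /brk mulrDl mulrDr -scalerAl -scalerAr opprD addrACA -scalerBr.
Qed.

Lemma brk_linearr c x x' y : brk y (c *: x + x') = c *: brk y x + brk y x'.
Proof. by rewrite brkN brk_linear opprD -scalerN -!brkN. Qed.

Lemma brk0 y : brk 0 y = 0. Proof. by rewrite /brk mul0r mulr0 subr0. Qed.

Lemma brkxx x : brk x x = 0. Proof. by rewrite /brk subrr. Qed.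

Lemma brk_eq0 x y : brk x y = 0 -> x * y = y * x.
Proof. by move/eqP; rewrite subr_eq0 => /eqP. Qed.

(** [u] times any product of [i] elements of [H] is zero. *)
Fixpoint rkill H (i : nat) u : Prop :=
  if i is i'.+1 then forall h, H h -> rkill H i' (u * h) else u = 0.

(** Any product of [i] elements of [H] times [u] is zero. *)
Fixpoint lkill H (i : nat) u : Prop :=
  if i is i'.+1 then forall h, H h -> lkill H i' (h * u) else u = 0.

Lemma subspace_rkill H i : subspace (rkill H i).
Proof.
split; elim: i => [|i IH] //=.
- by move=> h _; rewrite mul0r.
- by move=> c x y -> ->; rewrite scaler0 addr0.
- by move=> c x y hx hy h Hh; rewrite mulrDl -scalerAl; apply: IH; auto.
Qed.

Lemma rkillM H i b u : rkill H i u -> rkill H i (b * u).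
Proof.
elim: i u => [|i IH] u /=; first by move=> ->; rewrite mulr0.
by move=> hu h Hh; rewrite -mulrA; apply/IH/hu.
Qed.

Lemma rkillS H i u : rkill H i u -> rkill H i.+1 u.
Proof.
elim: i u => [|i IH] u /=; first by move=> -> h _; rewrite mul0r.
by move=> hu h Hh; apply/IH/hu.
Qed.

Lemma rkill_normalize H y i u : (forall h, H h -> H (brk y h)) ->
  rkill H i u -> rkill H i (u * y).
Proof.
move=> hy; elim: i u => [|i IH] u /=; first by move=> ->; rewrite mul0r.
move=> hu h Hh; suff -> : u * y * h = u * h * y + u * brk y h.
  by apply: subspaceD; [exact: subspace_rkill|apply/IH/hu|apply/hu/hy].
by rewrite /brk mulrBr !mulrA addrCA subrr addr0.
Qed.

Lemma rkillP H i u : rkill H i u <->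
  forall s : seq Q, size s = i -> (forall x, x \in s -> H x) ->
    u * (\prod_(x <- s) x) = 0.
Proof.
elim: i u => [|i IH] u /=.
  split=> [-> s _ _|/(_ [::])]; first by rewrite mul0r.
  by rewrite big_nil mulr1; apply.
split=> [hu [//|x s] [ss] hs|hu h Hh].
  have /IH h : rkill H i (u * x) by apply/hu/hs/mem_head.
  by rewrite big_cons mulrA h // => z zs; apply: hs; rewrite inE zs orbT.
apply/IH => s ss hs; rewrite -mulrA.
have := hu (h :: s); rewrite big_cons; apply; first by rewrite /= ss.
by move=> x; rewrite inE => /orP[/eqP->|/hs].
Qed.

Lemma lkillP H i u : lkill H i u <->
  forall s : seq Q, size s = i -> (forall x, x \in s -> H x) ->
    (\prod_(x <- s) x) * u = 0.
Proof.
elim: i u => [|i IH] u /=.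
  split=> [-> s _ _|/(_ [::])]; first by rewrite mulr0.
  by rewrite big_nil mul1r; apply.
split=> [hu s|hu h Hh].
  case/lastP: s => [//|s x]; rewrite size_rcons => -[ss] hs.
  have /IH h : lkill H i (x * u) by apply/hu/hs; rewrite mem_rcons mem_head.
  rewrite -cats1 big_cat big_seq1 /= -mulrA h // => z zs.
  by apply: hs; rewrite mem_rcons inE zs orbT.
apply/IH => s ss hs; rewrite mulrA.
have := hu (rcons s h); rewrite -cats1 big_cat big_seq1 cats1 /=; apply.
  by rewrite size_rcons ss.
by move=> x; rewrite mem_rcons inE => /orP[/eqP->|/hs].
Qed.

Lemma rkill1_lkill1 H i : rkill H i 1 -> lkill H i 1.
Proof.
by move=> /rkillP h; apply/lkillP => s ss hs; rewrite mulr1 -[RHS](h s) ?mul1r.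
Qed.

(** If the products of [m] elements of [H] vanish, [y] is nilpotent and normalises [H],
    then the products of [m * k] elements of [H + K y] vanish.  In the filtration by the
    left ideals [rkill H i], multiplication by an element of [H] lowers the index, while
    [y] preserves each term. *)
Lemma rkill_adjoin H y m k : (forall h, H h -> H (brk y h)) ->
  y ^+ k = 0 -> rkill H m 1 -> rkill (adjoin H y) (m * k) 1.
Proof.
move=> hy yk; move: 1; elim: m => [|i IH] u.
  by rewrite mul0n /= => ->.
rewrite mulSn => hu.
suff main j w : rkill H i.+1 w -> rkill H i (w * y ^+ j) ->
    rkill (adjoin H y) (j + i * k) w.
  by apply: main => //; rewrite yk mulr0; case: (subspace_rkill H i).
elim: j w => [|j IHj] w hw hwj.
  by rewrite add0n; apply: IH; rewrite -[w]mulr1.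
move=> z [h Hh [c ->]].
have whi : rkill H i (w * h) by apply: hw.
have e : w * (h + c *: y) = c *: (w * y) + w * h.
  by rewrite mulrDr -scalerAr addrC.
(* Modulo [rkill H i], multiplying by [h + c y] amounts to multiplying by [c y]. *)
apply: IHj; rewrite e.
  case: (subspace_rkill H i.+1) => _; apply; first exact: rkill_normalize.
  exact: rkillS.
rewrite mulrDl -scalerAl -[w * y * _]mulrA -exprS.
case: (subspace_rkill H i) => _; apply=> //.
have hyj h' : H h' -> H (brk y h') by apply: hy.
elim: (j) => [|l IHl]; first by rewrite expr0 mulr1.
by rewrite exprSr mulrA; apply: rkill_normalize.
Qed.

(** All products of [u] with [r] elements of [H], each on either side, are zero. *)
Fixpoint bikill H (r : nat) u : Prop :=
  if r is r'.+1 then forall h, H h -> bikill H r' (u * h) /\ bikill H r' (h * u)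
  else u = 0.

Lemma subspace_bikill H r : subspace (bikill H r).
Proof.
split; elim: r => [|r IH] //=.
- by move=> h _; rewrite mul0r mulr0.
- by move=> c x y -> ->; rewrite scaler0 addr0.
- move=> c x y hx hy h Hh; rewrite mulrDl mulrDr -scalerAl -scalerAr.
  by have [? ?] := hx h Hh; have [? ?] := hy h Hh; split; apply: IH.
Qed.

Lemma bikillM H r i j a u b : lkill H i a -> rkill H j b -> (i + j <= r.+1)%N ->
  bikill H r (a * u * b).
Proof.
have z r' : bikill H r' 0 by case: (subspace_bikill H r').
case: i => [|i] ha; first by rewrite ha !mul0r => _ _; exact: z.
case: j => [|j] hb; first by rewrite hb mulr0 => _; exact: z.
elim: r i j a b ha hb => [|r IH] i j a b; first by rewrite addSn addnS.
move=> /= ha hb; rewrite addSn addnS !ltnS => ij h Hh; split.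
  rewrite -mulrA; case: j hb ij => [|j] hb ij; first by rewrite (hb h Hh) mulr0; exact: z.
  by apply: (IH i j) => //; [exact: hb].
rewrite !mulrA; case: i ha ij => [|i] ha ij; first by rewrite (ha h Hh) !mul0r; exact: z.
by apply: (IH i j) => //; [exact: ha|rewrite addnS].
Qed.

(** Bracketing [u] repeatedly with elements of [H] ends in [0]; the last bracket outside
    [H] normalises [H]. *)
Lemma normalizer_ex H L r u : (forall h, H h -> L h) ->
  (forall x y, L x -> L y -> L (brk x y)) -> H 0 ->
  L u -> ~ H u -> bikill H r u ->
  exists y, [/\ L y, ~ H y & forall h, H h -> H (brk y h)].
Proof.
move=> HL cL H0; elim: r u => [|r IH] u Lu Hu /=; first by move=> u0; case: Hu; rewrite u0.
move=> hu; have [hb|] := pselect (forall h, H h -> H (brk u h)); first by exists u.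
move=> /existsNP[h /not_implyP[Hh nH]].
apply: (IH (brk u h)) => //; first by apply/cL/HL.
by have [? ?] := hu h Hh; apply: subspaceB => //; apply: subspace_bikill.
Qed.

(** Engel's theorem, in Jacobson's form: the associative algebra (without unit) generated
    by a finite-dimensional Lie algebra of nilpotent elements is nilpotent. *)
Lemma engel L : subspace L -> fin_gen L ->
  (forall x y, L x -> L y -> L (brk x y)) ->
  (forall x, L x -> exists k, x ^+ k = 0) ->
  exists m, rkill L m 1.
Proof.
move=> sL fL cL nL.
pose P H := (forall x y, H x -> H y -> H (brk x y)) /\ exists m, rkill H m 1.
suff [] : P L by [].
apply: fin_gen_rect => //.
  split; first by move=> x y -> ->; rewrite /brk mulr0 subrr.
  by exists 1%N => h ->; rewrite mulr0.
move=> H sH HL [cH [m hm]] nLH.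
have [u Lu Hu] : exists2 y, L y & ~ H y.
  by move/existsNP: nLH => [y /not_implyP[]]; exists y.
have hbi : bikill H (m + m) u.
  rewrite -[u]mul1r -[1 * u]mulr1; apply: (@bikillM H _ m m) => //.
  exact: rkill1_lkill1.
have [y [Ly Hy ny]] := normalizer_ex HL cL sH.1 Lu Hu hbi.
exists y; split=> //; split.
  move=> _ _ [x Hx [a ->]] [x' Hx' [b ->]].
  rewrite addrC [x' + _]addrC brk_linear !brk_linearr.
  rewrite brkxx scaler0 add0r.
  exists (a *: brk y x' + (b *: brk x y + brk x x')); last first.
    by exists 0; rewrite scale0r addr0.
  apply: sH.2; first exact: ny.
  by apply: sH.2; [rewrite brkN -scaleN1r; apply: subspaceZ => //; exact: ny|exact: cH].
have [k yk] := nL y Ly.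
by exists (m * k)%N; apply: rkill_adjoin.
Qed.

End Engel.

(** * Commutators as derivations *)

Section Brackets.
Variables (K : fieldType) (Q : algType K).
Implicit Types (x y c d : Q).

Lemma brkMl c d y : brk (c * d) y = brk c y * d + c * brk d y.
Proof. by rewrite /brk mulrBl mulrBr !mulrA [RHS]addrC addrA subrK. Qed.

Lemma brkBl x x' y : brk (x - x') y = brk x y - brk x' y.
Proof.
by rewrite addrC -scaleN1r brk_linear scaleN1r addrC.
Qed.

Lemma brk_exprl c y n : GRing.comm c (brk c y) ->
  brk (c ^+ n) y = (c ^+ n.-1 * brk c y) *+ n.
Proof.
move=> cc; elim: n => [|n IH].
  by rewrite expr0 /brk mul1r mulr1 subrr mulr0n.
rewrite exprS brkMl IH /=.
case: n {IH} => [|n]; first by rewrite expr0 mulr1 mul1r mulr0n mulr0 addr0.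
rewrite [n.+1.-1]/= mulrnAr mulrA -exprS [in RHS]mulrS; congr (_ + _).
exact: (commrX n.+1 (commr_sym cc)).
Qed.

Lemma nilp_add c d m n : GRing.comm c d -> c ^+ m = 0 -> d ^+ n = 0 ->
  (c + d) ^+ (m + n) = 0.
Proof.
move=> cd cm dn; rewrite exprDn_comm // big1 // => i _.
have [im|mi] := leqP (i : nat) n.
  have -> : (m + n - i = n - i + m)%N by rewrite -addnBA // addnC.
  by rewrite exprD cm mulr0 mul0r mul0rn.
by rewrite -(subnKC (ltnW mi)) exprD dn mul0r mulr0 mul0rn.
Qed.

(** Nilpotency is inherited along a derivation, in characteristic zero.  With [d] the
    derivative of [c], applying the derivation to [c ^ (m + 1) * d ^ (2 i) = 0] and
    multiplying by [d] gives [c ^ m * d ^ (2 i + 2) = 0]. *)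
Lemma nilp_brk (chK : forall n, n.+1%:R != 0 :> K) c y n :
  GRing.comm c (brk c y) -> GRing.comm c (brk (brk c y) y) ->
  GRing.comm (brk c y) (brk (brk c y) y) -> c ^+ n = 0 -> brk c y ^+ (n * 2) = 0.
Proof.
set d := brk c y; set d' := brk d y => cd cd' dd' cn.
suff H i : (i <= n)%N -> c ^+ (n - i) * d ^+ (i * 2) = 0.
  by have := H n (leqnn n); rewrite subnn mul1r.
elim: i => [|i IH] lin; first by rewrite subn0 cn mul0r.
have {IH} := IH (ltnW lin).
rewrite -(subnSK lin); move: (n - i.+1)%N => m h.
have : brk (c ^+ m.+1 * d ^+ (i * 2)) y * d = 0 by rewrite h brk0 mul0r.
rewrite brkMl !brk_exprl // -/d -/d' -[m.+1.-1]/m mulrDl.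
have -> : c ^+ m.+1 * (d ^+ (i * 2).-1 * d' *+ (i * 2)) * d = 0.
  case: i {lin} h => [|i] h; first by rewrite mulr0n mulr0 mul0r.
  rewrite mulrnAr mulrnAl -!mulrA -dd' [d ^+ _ * _]mulrA -exprSr.
  by rewrite [c ^+ _ * _]mulrA prednK // h mul0r mul0rn.
rewrite addr0 !mulrnAl => /eqP; rewrite -scaler_nat scaler_eq0 (negbTE (chK m)) /=.
move=> /eqP; rewrite -!mulrA => <-; congr (_ * _).
by rewrite mulSn exprD expr2 -mulrA -exprSr exprS.
Qed.

Lemma jacobi x y z : brk (brk x y) z = brk (brk x z) y + brk x (brk y z).
Proof.
rewrite [brk x y]/brk brkBl !brkMl [brk y z * x + _]addrC opprD addrACA.
by rewrite -/(brk _ _) -/(brk x _).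
Qed.

Lemma brkMr c d x : brk x (c * d) = brk x c * d + c * brk x d.
Proof. by rewrite brkN brkMl opprD -mulNr -mulrN -!brkN. Qed.

Lemma brkDr x c d : brk x (c + d) = brk x c + brk x d.
Proof. by rewrite -[c]scale1r brk_linearr !scale1r. Qed.

Lemma brkZr (l : K) x u : brk x (l *: u) = l *: brk x u.
Proof. by rewrite /brk -scalerAr -scalerAl scalerBr. Qed.

(** The Kleinecke-Shirokov identity. *)
Lemma iter_brk_expr x y n : brk x (brk x y) = 0 ->
  iter n (brk x) (y ^+ n) = n`!%:R *: brk x y ^+ n.
Proof.
move=> h; set c := brk x y; set D := brk x.
have Dm m u : iter m.+1 D (y * u) =
    y * iter m.+1 D u + m.+1%:R *: (c * iter m D u).
  elim: m => [|m IH]; first by rewrite /= /D brkMr scale1r addrC.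
  rewrite iterS IH {1}/D brkDr brkZr !brkMr h mul0r add0r -/c -/D -!iterS.
  rewrite -[in RHS]natr1 scalerDl scale1r [c * _ + _]addrC -addrA.
  by congr (_ + _); rewrite addrC.
have [] : iter n D (y ^+ n) = n`!%:R *: c ^+ n /\ iter n.+1 D (y ^+ n) = 0.
  elim: n => [|n [IH1 IH2]].
    by rewrite /= !expr0 scale1r /D /brk mulr1 mul1r subrr.
  have e1 : iter n.+1 D (y ^+ n.+1) = n.+1`!%:R *: c ^+ n.+1.
    rewrite exprS Dm IH2 mulr0 add0r IH1 -scalerAr scalerA -exprS.
    by rewrite factS natrM.
  split=> //; rewrite iterS e1 /D brkZr.
  have -> : brk x (c ^+ n.+1) = 0 
    by apply/eqP; rewrite /brk subr_eq0; apply/eqP/commrX/brk_eq0.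
  by rewrite scaler0.
by [].
Qed.
End Brackets.

(** * Finite-dimensional commutative ideals *)

Section CommonKernel.
Variables (K : closedFieldType) (d : nat).
Implicit Types (M : 'M[K]_d.+1) (L : set 'M[K]_d.+1).

Lemma mx_nilpotent M : (forall a (v : 'rV_d.+1), v != 0 -> v *m M = a *: v -> a = 0) ->
  exists k, M ^+ k = 0.
Proof.
move=> hM; have [r hr] := closed_field_poly_normal (char_poly M).
rewrite (monicP (char_poly_monic M)) scale1r in hr.
have r0 z : z \in r -> z = 0.
  move=> zr; have : eigenvalue M z.
    by rewrite eigenvalue_root_char hr root_prod_XsubC.
  by case/eigenvalueP => v vM v0; apply: hM vM.
exists (size r); have := Cayley_Hamilton M.
have -> : char_poly M = 'X ^+ size r.
  rewrite hr big_seq (eq_bigr (fun=> 'X)); last first.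
    by move=> z /r0 ->; rewrite subr0.
  by rewrite -big_seq big_const_seq count_predT iter_mulr_1.
by rewrite rmorphXn /= horner_mx_X.
Qed.

Lemma fin_gen_mx L : fin_gen L.
Proof.
exists (d.+1 * d.+1)%N, (fun i => vec_mx (delta_mx 0 i)) => M _.
exists (mxvec M) => //.
rewrite -[RHS](mxvecK M) [in RHS](row_sum_delta (mxvec M)) linear_sum /comb.
by apply: eq_bigr => i _; rewrite linearZ.
Qed.

(** Engel's theorem for matrices acting on row vectors. *)
Lemma common_kernel L : subspace L ->
  (forall x y, L x -> L y -> L (brk x y)) ->
  (forall M, L M -> exists k, M ^+ k = 0) ->
  exists2 v : 'rV[K]_d.+1, v != 0 & forall M, L M -> v *m M = 0.
Proof.
move=> sL cL nL; have [m hm] := engel sL (fin_gen_mx L) cL nL.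
suff H i (u : 'M[K]_d.+1) (v : 'rV[K]_d.+1) : rkill L i u -> v *m u != 0 ->
    exists2 v : 'rV[K]_d.+1, v != 0 & forall M, L M -> v *m M = 0.
  apply: (H m 1 (const_mx 1)) => //; rewrite -[X in _ *m X]/(1%:M) mulmx1.
  by apply/eqP => /rowP /(_ 0) /eqP; rewrite !mxE oner_eq0.
elim: i u => [|i IH] u /= hu vu; first by rewrite hu mulmx0 eqxx in vu.
have [|/existsNP[M /not_implyP[LM /eqP vM]]] :=
  pselect (forall M, L M -> v *m u *m M = 0); first by exists (v *m u).
by apply: (IH (u * M)); [exact: hu|rewrite mulmxA].
Qed.

End CommonKernel.

(** Here [qn] is any notion of quasinilpotence, [G] a Lie subalgebra and [J] a
    finite-dimensional commutative ideal for [G]; [J] need not be contained in [G]. *)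
Section AbelianIdeal.
Variables (K : closedFieldType) (Q : algType K).
Hypothesis chK : forall n, n.+1%:R != 0 :> K.
Variables (G qn : set Q).
Hypothesis sG : subspace G.
Hypothesis cG : forall x y : Q, G x -> G y -> G (brk x y).
Hypothesis qn_central :
  forall c, (forall x, G x -> brk c x = 0) -> qn c -> c = 0.
Hypothesis qn_brk : forall x y, brk x (brk x y) = 0 -> qn (brk x y).
Hypothesis qn_linear :
  forall a c d, GRing.comm c d -> qn c -> qn d -> qn (a *: c + d).
Hypothesis ad_bounded : forall (x : Q) (mu : K), mu != 0 ->
  exists k, forall u : Q, brk u x = (k%:R * mu) *: u -> u = 0.
Hypothesis nil_ideal : forall N : set Q, subspace N ->
  (forall c x, N c -> G x -> N (brk c x)) ->
  (exists m, rkill N m 1) -> forall c, N c -> c = 0.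

Variable J : set Q.
Hypothesis sJ : subspace J.
Hypothesis fJ : fin_gen J.
Hypothesis iJ : forall c x, J c -> G x -> J (brk c x).
Hypothesis aJ : forall c d, J c -> J d -> GRing.comm c d.

(* The span of the brackets of [J] with [G]. *)
Let n : set Q := lspan [set z | exists c x, [/\ J c, G x & z = brk c x]].

Let sn : subspace n. Proof. exact: subspace_lspan. Qed.

Let nJ : n `<=` J.
Proof. by move=> z; apply=> // _ [c [x [Jc Gx ->]]]; apply: iJ. Qed.

Let n_brk c x : J c -> G x -> n (brk c x).
Proof. by move=> Jc Gx; apply: sub_lspan; exists c, x. Qed.

Let n_qn : n `<=` qn.
Proof.
move=> z nz; suff [] : J z /\ qn z by [].
apply: (nz (fun z => J z /\ qn z)).
  split; first by split; [case: sJ|rewrite -(brk0 0); apply: qn_brk; rewrite !brk0].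
  move=> a c d [Jc qc] [Jd qd]; split; first by case: sJ => _; apply.
  by apply: qn_linear => //; apply: aJ.
move=> _ [c [x [Jc Gx ->]]]; split; first exact: iJ.
by apply: qn_brk; rewrite /brk (aJ Jc (iJ Jc Gx)) subrr.
Qed.

Let n_reduced c k : n c -> c ^+ k = 0 -> c = 0.
Proof.
pose N : set Q := [set c | n c /\ exists k, c ^+ k = 0].
move=> nc ck; suff H : forall c, N c -> c = 0 by apply: H; split=> //; exists k.
have sN : subspace N.
  split; first by split; [case: sn|exists 1%N; rewrite expr1].
  move=> a x y [nx [i xi]] [ny [j yj]]; split; first by case: sn => _; apply.
  exists (i + j)%N; apply: nilp_add => //; last by rewrite exprZn xi scaler0.
  by apply: aJ; [apply: (nJ (subspaceZ a sn nx))|exact: nJ].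
apply: nil_ideal => //.
  move=> z x [nz [i zi]] Gx; split; first exact: (n_brk (nJ nz) Gx).
  have Jz := nJ nz; have Jd := iJ Jz Gx.
  exists (i * 2)%N; apply: nilp_brk => //; apply: aJ => //; exact: iJ.
apply: engel => //.
- by case: fJ => m [s hs]; exists m, s => z [/nJ/hs].
- move=> x y [nx _] [ny _].
  by rewrite /brk (aJ (nJ nx) (nJ ny)) subrr; case: sN.
- by move=> x [].
Qed.

Let n_eigen c x mu : n c -> brk c x = mu *: c -> mu != 0 -> c = 0.
Proof.
move=> nc cx mu0; have [k hk] := ad_bounded x mu0.
apply: (n_reduced (k := k) nc); apply: hk.
rewrite brk_exprl; last by rewrite /GRing.comm cx -scalerAr -scalerAl.
rewrite cx -scalerAr; case: k => [|k]; first by rewrite mul0r scale0r mulr0n.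
by rewrite -exprSr -scaler_nat scalerA.
Qed.

(** A finite-dimensional commutative ideal of [G] commutes with [G]. *)
Lemma abelian_ideal_central c x : J c -> G x -> brk c x = 0.
Proof.
move=> Jc Gx; have := n_brk Jc Gx; move: (brk c x) => {x Gx Jc}c nc.
have [] := exists_basis sn; first by case: fJ => m [s hs]; exists m, s => z /nJ/hs.
move=> [|d] [e [fe en]].
  by move: nc; rewrite -en => -[v _ <-]; rewrite /comb big_ord0.
pose L : set 'M[K]_d.+1 := [set M | exists2 x, G x &
  forall v, brk (comb e v) x = comb e (v *m M)].
have nv v : n (comb e v) by rewrite -en; exists v.
have eI v : v != 0 -> comb e v != 0 by apply: contraNN => /eqP /fe ->.
have sL : subspace L.
  split.
    exists 0; first by case: sG.
    by move=> v; rewrite mulmx0 comb0 /brk mulr0 mul0r subrr.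
  move=> a M M' [x Gx hx] [x' Gx' hx']; exists (a *: x + x').
    by case: sG => _; apply.
  move=> v; rewrite brk_linearr hx hx' mulmxDr -scalemxAr.
  by rewrite comb_linear.
have [] := common_kernel sL.
- move=> M M' [x Gx hx] [x' Gx' hx']; exists (brk x x'); first exact: cG.
  move=> v; have := jacobi (comb e v) x x'.
  rewrite !(hx, hx') => /eqP; rewrite addrC -subr_eq => /eqP <-.
  have -> : v *m brk M M' = -1 *: (v *m M' *m M) + v *m M *m M'.
    by rewrite scaleN1r addrC /brk -!mulmxE mulmxBr !mulmxA.
  by rewrite comb_linear scaleN1r addrC.
- move=> M [x Gx hx]; apply: mx_nilpotent => a v v0 vM.
  apply/eqP/negPn/negP => a0; move/eqP: (eI v v0); apply.
  by apply: (@n_eigen _ x a (nv v)) => //; rewrite hx vM combZ.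
move=> v v0 hv; suff : comb e v = 0 by move/eqP; rewrite (negbTE (eI v v0)).
apply: qn_central; last exact: n_qn.
move=> x Gx; have /choice[r hr] : forall i, exists w, comb e w = brk (e i) x.
  move=> i; have : n (brk (e i) x).
    apply: n_brk => //; apply: nJ; rewrite -en; exists (delta_mx 0 i) => //.
    rewrite /comb (bigD1 i) //= mxE !eqxx scale1r big1 ?addr0 // => j ji.
    by rewrite mxE (negbTE ji) andbF scale0r.
  by rewrite -en => -[w _ <-]; exists w.
have hM w : brk (comb e w) x = comb e (w *m \matrix_(i, j) r i 0 j).
  have -> : brk (comb e w) x = comb (fun i => brk (e i) x) w.
    rewrite /comb /brk mulr_suml mulr_sumr -sumrB; apply: eq_bigr => i _.
    by rewrite -scalerAl -scalerAr -scalerBr.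
  apply: comb_mulmx => i; rewrite -hr; congr comb.
  by apply/rowP => j; rewrite !mxE.
by rewrite hM hv ?comb0 //; exists x.
Qed.

End AbelianIdeal.

(** * Gauges of absolutely convex neighbourhoods *)

Section Gauge.
Variables (R : realType) (E : tvsType R[i]).
Implicit Types (U V W : set E) (x y : E) (a b c d : R[i]).

(** Absolutely convex neighbourhoods of [0]. *)
Definition absconvex_nbhs U : Prop :=
  nbhs 0 U /\ forall a b x y, `|a| + `|b| <= 1 -> U x -> U y -> U (a *: x + b *: y).

(** The gauge (Minkowski functional) of [U] at [x] is witnessed to be at most [c].  The
    bound [c] is a nonnegative real number, regarded as a complex scalar. *)
Definition gauge_le U c x : Prop := 0 <= c /\ exists2 y, U y & x = c *: y.

Lemma absconvexZ U a x : absconvex_nbhs U -> `|a| <= 1 -> U x -> U (a *: x).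
Proof.
move=> [_ hU] a1 Ux; have := @hU a 0 x x; rewrite normr0 addr0 scale0r addr0.
by apply.
Qed.

Lemma absconvex0 U : absconvex_nbhs U -> U 0.
Proof. by move=> [/nbhs_singleton]. Qed.

Lemma gauge_le_mem U x : absconvex_nbhs U -> gauge_le U 1 x <-> U x.
Proof.
move=> aU; split; first by move=> [_ [y Uy ->]]; rewrite scale1r.
by move=> Ux; split=> //; exists x => //; rewrite scale1r.
Qed.

Lemma gauge_le0 U : absconvex_nbhs U -> gauge_le U 0 0.
Proof. by move=> aU; split=> //; exists 0; [exact: absconvex0|rewrite scaler0]. Qed.

Lemma gauge_leD U c d x y : absconvex_nbhs U ->
  gauge_le U c x -> gauge_le U d y -> gauge_le U (c + d) (x + y).
Proof.
move=> aU [c0 [x' Ux ->]] [d0 [y' Uy ->]]; split; first exact: addr_ge0.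
have [cd0|cd0] := eqVneq (c + d) 0.
  exists 0; first exact: absconvex0.
  move/eqP: cd0; rewrite paddr_eq0 // => /andP[/eqP -> /eqP ->].
  by rewrite !scale0r addr0 scaler0.
have cdp : 0 < c + d by rewrite lt0r cd0 addr_ge0.
exists ((c / (c + d)) *: x' + (d / (c + d)) *: y').
  apply: aU.2 => //; rewrite !ger0_norm ?divr_ge0 ?addr_ge0 //.
  by rewrite -mulrDl divff.
by rewrite scalerDr !scalerA !(mulrC (c + d)) !divfK.
Qed.

Lemma gauge_leZ U c a x : absconvex_nbhs U -> gauge_le U c x -> gauge_le U (`|a| * c) (a *: x).
Proof.
move=> aU [c0 [y Uy ->]]; split; first exact: mulr_ge0.
have [->|a0] := eqVneq a 0.
  by exists y => //; rewrite normr0 mul0r !scale0r.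
exists ((a / `|a|) *: y).
  by apply: absconvexZ => //; rewrite normrM normfV normr_id divff ?normr_eq0.
rewrite !scalerA; congr (_ *: _).
by rewrite mulrAC [`|a| * _]mulrC divfK ?normr_eq0.
Qed.

Lemma gauge_le_le U c d x : absconvex_nbhs U -> c <= d -> gauge_le U c x -> gauge_le U d x.
Proof.
move=> aU cd hx; rewrite -[d](subrK c) -[x]add0r; apply: gauge_leD => //.
by split; [rewrite subr_ge0|exists 0; [exact: absconvex0|rewrite scaler0]].
Qed.

Lemma gauge_le_bigsum U (I : Type) (r : seq I) (c : I -> R[i]) (F : I -> E) :
  absconvex_nbhs U -> (forall i, gauge_le U (c i) (F i)) ->
  gauge_le U (\sum_(i <- r) c i) (\sum_(i <- r) F i).
Proof.
move=> aU hF; elim/big_rec2: _ => [|i x d _ h]; first exact: gauge_le0.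
by apply: gauge_leD.
Qed.

Lemma gauge_le_sum U n (c : R[i]) (F : nat -> E) : absconvex_nbhs U ->
  (forall k, gauge_le U c (F k)) -> gauge_le U (n%:R * c) (\sum_(k < n) F k).
Proof.
move=> aU hF; have := gauge_le_bigsum (index_enum 'I_n) aU (fun k : 'I_n => hF k).
by rewrite sumr_const card_ord mulr_natl.
Qed.

Lemma gauge_leN U c x : absconvex_nbhs U -> gauge_le U c x -> gauge_le U c (- x).
Proof.
by move=> aU /(gauge_leZ (-1) aU); rewrite normrN1 mul1r scaleN1r.
Qed.

(** In a locally convex space: from a convex neighbourhood [V] one gets the set of all
    [x] whose multiples by the closed unit disc lie in [V]. *)
Lemma absconvex_base W : nbhs 0 W -> exists2 U, absconvex_nbhs U & U `<=` W.
Proof.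
move=> W0; have [B Bc [Bo Bb]] := @locally_convex R[i] E.
have [V [BV V0] VW] := Bb 0 W W0.
have cV : convex_set V by apply: Bc; rewrite inE.
have V0' : nbhs 0 V by apply: open_nbhs_nbhs; split=> //; apply: Bo.
have V00 := nbhs_singleton V0'.
have convV a x y : 0 <= a -> a <= 1 -> V x -> V y -> V (a *: x + (1 - a) *: y).
  move=> a0 a1 Vx Vy; have := cV x y (Itv01 a0 a1); rewrite !inE; exact.
have addV a b x y : 0 <= a -> 0 <= b -> a + b <= 1 -> V x -> V y ->
    V (a *: x + b *: y).
  move=> a0 b0 ab1 Vx Vy; have [ab0|ab0] := eqVneq (a + b) 0.
    move/eqP: ab0; rewrite paddr_eq0 // => /andP[/eqP -> /eqP ->].
    by rewrite !scale0r addr0.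
  have abp : 0 < a + b by rewrite lt0r ab0 addr_ge0.
  have -> : a *: x + b *: y = (a + b) *: ((a / (a + b)) *: x +
      (1 - a / (a + b)) *: y) + (1 - (a + b)) *: 0.
    rewrite scaler0 addr0 scalerDr !scalerA mulrBr !(mulrC (a + b)) !divfK //.
    by rewrite mul1r addrAC subrr add0r.
  apply: (convV (a + b)) => //; first exact: ltW.
  apply: (convV (a / (a + b))) => //; first exact: divr_ge0 (ltW abp).
  by rewrite ler_pdivrMr // mul1r lerDl.
exists [set x | forall a, `|a| <= 1 -> V (a *: x)]; last first.
  by move=> x /(_ 1); rewrite normr1 scale1r => h; apply/VW/h.
split.
  have := @scale_continuous R[i] E (0, 0) V; rewrite /= scaler0 => /(_ V0').
  move=> [[P1 P2] [/= P10 P20] PV].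
  have [e /= e0 Pe] := (nbhs_ballP (0 : R[i]^o) P1).1 P10.
  have e20 : e / 2 != 0 by rewrite mulf_neq0 ?invr_eq0 ?gt_eqF.
  apply: filterS (nbhs0Z e20 P20) => _ [y P2y <-] a a1; rewrite scalerA.
  apply: (PV (a * (e / 2), y)); split=> //=; apply: Pe.
  rewrite -ball_normE /= sub0r normrN normrM.
  rewrite (@le_lt_trans _ _ (e / 2)) //.
    have e2 : 0 <= e / 2 by rewrite divr_ge0 ?ltW.
    by rewrite (ger0_norm e2) ler_piMl.
  by rewrite ltr_pdivrMr // ltr_pMr // ltr1n.
move=> a b x y ab hx hy c c1; rewrite scalerDr !scalerA.
have nrm z w : V w -> (forall u, `|u| <= 1 -> V (u *: w)) ->
    exists2 w', V w' & z *: w = `|z| *: w'.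
  move=> Vw hw; have [->|z0] := eqVneq z 0.
    by exists 0; rewrite // normr0 !scale0r.
  exists ((z / `|z|) *: w).
    by apply: hw; rewrite normrM normfV normr_id divff ?normr_eq0.
  by rewrite scalerA [`|z| * _]mulrC divfK ?normr_eq0.
have V1 z : (forall u, `|u| <= 1 -> V (u *: z)) -> V z.
  by move=> /(_ 1); rewrite normr1 scale1r; apply.
have [x' Vx' ->] := nrm (c * a) x (V1 _ hx) hx.
have [y' Vy' ->] := nrm (c * b) y (V1 _ hy) hy.
apply: addV => //; rewrite !normrM -mulrDr.
by apply: mulr_ile1.
Qed.

Lemma nbhs_gauge_le U e x : absconvex_nbhs U -> 0 < e -> nbhs x [set y | gauge_le U e (y - x)].
Proof.
move=> aU e0; have := nbhsT x (nbhs0Z (lt0r_neq0 e0) aU.1).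
apply: filterS => _ [_ [y Uy <-] <-]; rewrite /= addrAC subrr add0r.
by split; [exact: ltW|exists y].
Qed.

Lemma nbhs_absconvex W x : nbhs x W ->
  exists2 U, absconvex_nbhs U & forall y, U (y - x) -> W y.
Proof.
move=> /(nbhsB (- x)); rewrite addNr => /absconvex_base[U aU UW].
exists U => // y /UW[z Wz]; rewrite [- x + z]addrC => /addIr <-.
by [].
Qed.

Lemma gauge_le_ex U x : absconvex_nbhs U -> exists c, gauge_le U c x.
Proof.
move=> aU; have := @scale_continuous R[i] E (0, x) U.
rewrite /= scale0r => /(_ aU.1) [[P1 P2] [/= P10 P20] PU].
have [e /= e0 Pe] := (nbhs_ballP (0 : R[i]^o) P1).1 P10.
exists (e / 2)^-1; split; first by rewrite invr_ge0 divr_ge0 ?ltW.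
have e20 : e / 2 != 0 by rewrite mulf_neq0 ?invr_eq0 ?gt_eqF.
exists ((e / 2) *: x); last by rewrite scalerA mulVf // scale1r.
apply: (PU (e / 2, x)); split=> /=; last exact: nbhs_singleton.
apply: Pe; rewrite -ball_normE /= sub0r normrN ger0_norm ?divr_ge0 ?ltW //.
by rewrite ltr_pdivrMr // ltr_pMr // ltr1n.
Qed.

(** The family is bounded in the sense of topological vector spaces. *)
Definition bounded_family (I : Type) (F : I -> E) : Prop :=
  forall U, absconvex_nbhs U -> exists c, forall i, gauge_le U c (F i).

(** The sequence tends to [0]. *)
Definition vanishing (w : nat -> E) : Prop :=
  forall U, absconvex_nbhs U -> exists N, forall n, (N <= n)%N -> U (w n).

End Gauge.

(** * Boundedness of products and resolvents *)

Section ComplexScalars.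
Variable R : realType.
Implicit Types c : R[i].

Lemma complex_nat_bound c : 0 <= c -> exists k : nat, c <= k%:R.
Proof.
move=> c0; have cE : c = (complex.Re c)%:C by rewrite RRe_real // ger0_real.
exists (Num.bound (complex.Re c)); rewrite cE -(rmorph_nat (real_complex R)) lecR.
by apply/ltW/archi_boundP; rewrite -ler0c -cE.
Qed.

Lemma Im_le_norm c : `|complex.Im c|%:C <= `|c|.
Proof.
have := normc_ge_Re (c * 'i); rewrite ReiNIm normrN normrM.
suff -> : `|'i : R[i]| = 1 by rewrite mulr1.
by rewrite normc_def /= expr0n expr1n add0r sqrtr1.
Qed.

Lemma norm_le_ReIm c : `|c| <= (`|complex.Re c| + `|complex.Im c|)%:C.
Proof.
rewrite normc_def lecR -[leRHS]ger0_norm ?addr_ge0 // -sqrtr_sqr ler_wsqrtr //.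
rewrite sqrrD !real_normK ?num_real // lerD2r lerDl.
by rewrite mulrn_wge0 // mulr_ge0.
Qed.

End ComplexScalars.

Section Boundedness.
Variables (R : realType) (A : ciaType R[i]).
Implicit Types (U V W : set A) (x y a b : A) (c d e l m : R[i]).

Lemma gauge_leM U : absconvex_nbhs U -> exists2 V, absconvex_nbhs V &
  forall c d x y, gauge_le V c x -> gauge_le V d y -> gauge_le U (c * d) (x * y).
Proof.
move=> aU; have := @Pilot.Defs.mul_continuous _ A (0, 0) U; rewrite /= mulr0 => /(_ aU.1).
move=> [[P1 P2] [/= P10 P20] PU].
have [V aV VP] := absconvex_base (filterI P10 P20).
exists V => // c d _ _ [c0 [x Vx ->]] [d0 [y Vy ->]]; split; first exact: mulr_ge0.
exists (x * y); last by rewrite -scalerAl -scalerAr scalerA.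
by apply: (PU (x, y)); split=> /=; [case: (VP _ Vx)|case: (VP _ Vy)].
Qed.

Lemma bounded_mul (I J : Type) (F : I -> A) (G : J -> A) :
  bounded_family F -> bounded_family G ->
  bounded_family (fun p : I * J => F p.1 * G p.2).
Proof.
move=> bF bG U aU; have [V aV VU] := gauge_leM aU.
have [c hc] := bF V aV; have [d hd] := bG V aV.
by exists (c * d) => p; apply: VU.
Qed.

Lemma bounded_comp (I J : Type) (F : I -> A) (h : J -> I) :
  bounded_family F -> bounded_family (F \o h).
Proof. by move=> bF U /bF[c hc]; exists c => j; apply: hc. Qed.

Lemma bounded_const (I : Type) x : bounded_family (fun _ : I => x).
Proof. by move=> U aU; have [c hc] := gauge_le_ex x aU; exists c. Qed.

(** The resolvent of [b] in the variable at the inverse of the spectral parameter. *)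
Definition res b l : A := (1 - l *: b)^-1.

Lemma res_near b l U e : 1 - l *: b \is a GRing.unit -> absconvex_nbhs U ->
  0 < e -> exists2 d, 0 < d & forall m, `|m - l| <= d -> gauge_le U e (res b m - res b l).
Proof.
move=> ul aU e0.
have := Pilot.Defs.inv_continuous _ ul _ (nbhs_gauge_le (1 - l *: b)^-1 aU e0).
move=> /nbhs_absconvex[V aV VU].
have [c hc] := gauge_le_ex b aV; have c0 : 0 <= c by case: hc.
exists (c + 1)^-1; first by rewrite invr_gt0 ltr_wpDl.
move=> m hm; apply: VU; rewrite opprB [l *: b - 1]addrC addrACA subrr add0r.
rewrite -scaleNr -scalerDl [- m + l]addrC.
apply/gauge_le_mem => //; apply: gauge_le_le (gauge_leZ _ aV hc) => //.
rewrite distrC (le_trans (ler_wpM2r c0 hm)) // mulrC ler_pdivrMr ?ltr_wpDl //.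
by rewrite mul1r lerDl.
Qed.

(** Compactness of the square [-1 <= Re l, Im l <= 1], which contains the unit disc and
    is contained in the disc of radius [2]. *)
Lemma res_bounded b : (forall l, `|l| <= 2 -> 1 - l *: b \is a GRing.unit) ->
  bounded_family (fun l : {l : R[i] | `|l| <= 1} => res b (sval l)).
Proof.
move=> ub U aU; pose f (p : R * R) := p.1 +i* p.2.
pose I1 : set R := `[(-1 : R), 1]%classic.
have cI : compact (I1 `*` I1) by apply: compact_setX; exact: segment_compact.
have I1P (s : R) : I1 s <-> `|s| <= 1.
  by rewrite /I1 /= in_itv /= ler_norml.
have := (compact_near_coveringP _).1 cI nat \oo
  (fun k p => gauge_le U k%:R (res b (f p))) _.
case.
  move=> [s t] [/= /I1P s1 /I1P t1].
  have ust : 1 - f (s, t) *: b \is a GRing.unit.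
    apply: ub; rewrite (le_trans (norm_le_ReIm _)) //=.
    rewrite -(rmorph_nat (real_complex R)) lecR.
    by rewrite (_ : 2%:R = 1 + 1) ?lerD // -natrD.
  have [c hc] := gauge_le_ex (res b (f (s, t))) aU.
  have [d d0 hd] := res_near ust aU (ltr01 : 0 < 1 :> R[i]).
  have [k hk] := @complex_nat_bound R c hc.1.
  have d0' : 0 < complex.Re d / 2.
    rewrite divr_gt0 //; move: d0; rewrite ltcE /= => /andP[_].
    exact.
  have dE : d = (complex.Re d)%:C by rewrite RRe_real // gtr0_real.
  exists ([set p : R * R | `|p.1 - s| <= complex.Re d / 2 /\ `|p.2 - t| <= complex.Re d / 2],
    [set n | (k.+1 <= n)%N]).
    split=> /=; last by exists k.+1.
    exists ([set z | `|z - s| <= complex.Re d / 2], [set z | `|z - t| <= complex.Re d / 2]).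
      split=> /=; apply/nbhs_ballP; exists (complex.Re d / 2) => //= z;
      by rewrite -ball_normE /= distrC => /ltW.
    by move=> [z1 z2] /= [].
  move=> [[s' t'] n] /= [[hs ht] kn].
  rewrite -[res b _](subrK (res b (f (s, t)))).
  apply: (@gauge_le_le _ _ _ (1 + k%:R)) => //; first by rewrite addrC natr1 ler_nat.
  apply: gauge_leD => //; last exact: gauge_le_le hc.
  apply: hd; rewrite (le_trans (norm_le_ReIm _)) //= [leRHS]dE lecR.
  by rewrite [leRHS](splitr (complex.Re d)) lerD.
move=> N _ hN; exists (N%:R) => -[l hl] /=.
have := hN N (leqnn N) (complex.Re l, complex.Im l).
rewrite /f /=.
have -> : complex.Re l +i* complex.Im l = l by case: (l).
apply; split=> /=; apply/I1P; rewrite -lecR.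
  exact: le_trans (normc_ge_Re l) hl.
exact: le_trans (Im_le_norm l) hl.
Qed.

End Boundedness.
(* These conclusions unfold to products, whose variables are to stay explicit. *)
Arguments bounded_mul {R A I J F G} _ _.
Arguments bounded_comp {R A I J F} h _.
Arguments bounded_const {R A} I x.
Arguments res_bounded {R A b} _.

(** * Roots of unity *)

Section RootsOfUnity.
Variable R : realType.

(** The complex number of modulus one and argument [t]. *)
Definition cis (t : R) : R[i] := cos t +i* sin t.

(** The standard primitive [n]-th root of unity, for [n > 0]. *)
Definition zeta (n : nat) : R[i] := cis (pi *+ 2 / n%:R).

Lemma cisX t n : cis t ^+ n = cis (t *+ n).
Proof.
elim: n => [|n IH]; first by rewrite expr0 mulr0n /cis cos0 sin0.
rewrite exprS IH mulrS /cis cosD sinD.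
by rewrite /GRing.mul /= [sin t * _ + _]addrC.
Qed.

Lemma norm_zeta n : `|zeta n| = 1.
Proof. by rewrite normc_def /= cos2Dsin2 sqrtr1. Qed.

Lemma norm_zetaX n k : `|zeta n ^+ k| = 1.
Proof. by rewrite normrX norm_zeta expr1n. Qed.

Lemma zetaXn n : zeta n ^+ n = 1.
Proof.
case: n => [|n]; first by rewrite expr0.
rewrite cisX -[_ *+ n.+1]mulr_natr divfK ?pnatr_eq0 //.
by rewrite /cis cos2pi sin2pi.
Qed.

Lemma zetaX_neq1 n i : (0 < i < n)%N -> zeta n ^+ i != 1.
Proof.
move=> /andP[i0 lin]; rewrite cisX; apply/eqP => -[h _].
have n0 : (0 < n%:R :> R) by rewrite ltr0n (leq_trans _ lin).
pose t : R := pi * (i%:R / n%:R).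
have e : pi *+ 2 / n%:R *+ i = t *+ 2 :> R.
  rewrite /t -[LHS]mulr_natr -[RHS]mulr_natr -[pi *+ 2]mulr_natr.
  by rewrite -!mulrA; congr (_ * _); rewrite mulrC -mulrA mulrCA.
have : sin t ^+ 2 = 0.
  move: h; rewrite e cos_mulr2n => /eqP; rewrite subr_eq -mulr2n.
  have := cos2Dsin2 t => h1 /eqP h2.
  have h3 : cos t ^+ 2 = 1.
    by apply/eqP; rewrite -(inj_eq (mulIf (_ : 2%:R != 0 :> R))) ?pnatr_eq0 //
      !mulr_natr h2.
  by apply/eqP; rewrite -(inj_eq (addrI (1 : R))) addr0 -{1}h3 h1.
move/eqP; rewrite expf_eq0 /=; apply/negP; rewrite gt_eqF //.
apply: sin_gt0_pi; apply/andP; split.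
  by rewrite mulr_gt0 ?pi_gt0 // divr_gt0 // ltr0n.
by rewrite gtr_pMr ?pi_gt0 // ltr_pdivrMr // mul1r ltr_nat.
Qed.

Lemma sum_zetaX n i : (0 < i < n)%N -> \sum_(k < n) zeta n ^+ (k * i) = 0.
Proof.
move=> hi; have h := subrX1 (zeta n ^+ i) n.
move: h; rewrite exprAC zetaXn expr1n subrr => /esym/eqP.
rewrite mulf_eq0 subr_eq0 (negbTE (zetaX_neq1 hi)) /= => /eqP h.
by rewrite -[RHS]h; apply: eq_bigr => k _; rewrite mulnC exprM.
Qed.

Lemma zeta_near1 (e : R[i]) : 0 < e ->
  exists N, forall n, (N <= n)%N -> `|zeta n - 1| <= e.
Proof.
move=> e0; have eE : e = (complex.Re e)%:C by rewrite RRe_real // gtr0_real.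
have r0 : 0 < complex.Re e / 2.
  by rewrite divr_gt0 //; move: e0; rewrite ltcE /= => /andP[_].
have := @continuous_cos R 0 _ (nbhsx_ballx _ _ r0).
have := @continuous_sin R 0 _ (nbhsx_ballx _ _ r0).
rewrite cos0 sin0 => -[d1 /= d10 h1] [d2 /= d20 h2].
have d0 : 0 < Num.min d1 d2 by rewrite lt_min d10 d20.
exists (Num.bound (pi *+ 2 / Num.min d1 d2)).+1 => n hn.
have n0 : 0 < n%:R :> R by rewrite ltr0n (leq_trans _ hn).
have p0 : 0 <= pi *+ 2 / n%:R :> R.
  by rewrite divr_ge0 ?ltW // mulrn_wgt0 // pi_gt0.
have hx : `|0 - pi *+ 2 / n%:R| < Num.min d1 d2.
  rewrite sub0r normrN ger0_norm // ltr_pdivrMr // mulrC -ltr_pdivrMr //.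
  apply: lt_trans (archi_boundP _) _; last by rewrite ltr_nat.
  by rewrite divr_ge0 // ?ltW // mulrn_wgt0 // pi_gt0.
have /h1 /= : ball_ Num.norm 0 d1 (pi *+ 2 / n%:R).
  by rewrite /ball_ /=; move: hx; rewrite lt_min => /andP[].
have /h2 /= : ball_ Num.norm 0 d2 (pi *+ 2 / n%:R).
  by rewrite /ball_ /=; move: hx; rewrite lt_min => /andP[].
rewrite -!ball_normE /= => hc hs.
rewrite (le_trans (norm_le_ReIm _)) // [leRHS]eE lecR.
rewrite [leRHS]splitr /zeta /cis /=; apply: lerD.
  by rewrite distrC ltW.
by rewrite oppr0 addr0 -normrN ltW // -sub0r.
Qed.

End RootsOfUnity.

(** * Powers tending to zero *)

Section PowersVanish.
Variables (R : realType) (A : ciaType R[i]).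
Implicit Types (U V W : set A) (x y a b : A) (c d e l m : R[i]).

Lemma resB b l m : 1 - l *: b \is a GRing.unit -> 1 - m *: b \is a GRing.unit ->
  res b m - res b l = (m - l) *: (res b l * b * res b m).
Proof.
move=> ul um; rewrite /res; set x := (1 - l *: b)^-1; set y := (1 - m *: b)^-1.
have -> : y - x = x * ((1 - l *: b) - (1 - m *: b)) * y.
  by rewrite mulrBr mulrBl mulVr // mul1r -mulrA divrr // mulr1.
by rewrite opprB addrC subrKA -scalerBl -scalerAr -scalerAl.
Qed.

(** Second-order Taylor formula for the resolvent. *)
Lemma resB2 b l m : 1 - l *: b \is a GRing.unit -> 1 - m *: b \is a GRing.unit ->
  res b m - res b l - (m - l) *: (res b l * b * res b l) =
  (m - l) ^+ 2 *: (res b l * b * (res b l * b * res b m)).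
Proof.
move=> ul um; rewrite resB // -scalerBr -mulrBr resB // -scalerAr scalerA expr2.
by rewrite !mulrA.
Qed.

Lemma sum_res b n : (forall k, 1 - zeta R n ^+ k *: b \is a GRing.unit) ->
  (\sum_(k < n) res b (zeta R n ^+ k)) * (1 - b ^+ n) = n%:R.
Proof.
move=> ub; rewrite mulr_suml.
have h (k : nat) : res b (zeta R n ^+ k) * (1 - b ^+ n) =
    \sum_(i < n) zeta R n ^+ (k * i) *: b ^+ i.
  have -> : b ^+ n = (zeta R n ^+ k *: b) ^+ n.
    by rewrite exprZn exprAC zetaXn expr1n scale1r.
  rewrite -opprB subrX1 -mulNr opprB mulrA mulVr // mul1r.
  by apply: eq_bigr => i _; rewrite exprZn exprM.
under eq_bigr do rewrite h.
rewrite exchange_big /=; case: n ub h => [|n] ub h; first by rewrite !big_ord0.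
rewrite big_ord_recl [X in _ + X]big1 ?addr0.
  rewrite (eq_bigr (fun=> 1)) ?sumr_const ?card_ord // => k _.
  by rewrite /= muln0 !expr0 scale1r.
move=> i _; rewrite -scaler_suml.
by rewrite sum_zetaX ?scale0r // lift0 /=; exact: (ltn_ord i).
Qed.

(** The sum of the resolvent over the [n]-th roots of unity is close to [n] times its value
    at [0].  The disc is divided into [n] concentric annuli of equal width.  Between
    two consecutive circles the sum changes, to first order, by a multiple of the sum [D]
    of the radial derivatives of the resolvent.  By the Cauchy-Riemann equations [D] is,
    to first order, a multiple of the sum of the increments of the resolvent around the
    circle, which is zero. *)
Lemma sum_res_near b n U C : (1 < n)%N -> absconvex_nbhs U -> 0 <= C ->
  (forall l, `|l| <= 1 -> 1 - l *: b \is a GRing.unit) ->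
  (forall l m, `|l| <= 1 -> `|m| <= 1 ->
     gauge_le U C (res b l * b * (res b l * b * res b m))) ->
  gauge_le U (n%:R * (C * (n%:R^-1 + `|zeta R n - 1|)))
    (\sum_(k < n) res b (zeta R n ^+ k) - n%:R).
Proof.
move=> n1 aU C0 ub hC; set z := zeta R n.
have n0' : 0 < n%:R :> R[i] by rewrite ltr0n ltnW.
pose S r := \sum_(k < n) res b (r * z ^+ k).
pose D r := \sum_(k < n) z ^+ k *: (res b (r * z ^+ k) * b * res b (r * z ^+ k)).
have nz r k : 0 <= r -> r <= 1 -> `|r * z ^+ k| <= 1.
  by move=> r0 r1; rewrite normrM norm_zetaX mulr1 ger0_norm.
have step l m : `|l| <= 1 -> `|m| <= 1 ->
    gauge_le U (`|m - l| ^+ 2 * C)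
      (res b m - res b l - (m - l) *: (res b l * b * res b l)).
  by move=> l1 m1; rewrite resB2 ?ub // -normrX; apply: gauge_leZ => //; apply: hC.
have zk1 (k : nat) : `|z ^+ k| = 1 by exact: norm_zetaX.
(* The radial derivatives on the circle of radius [r] sum to almost zero. *)
have hD r : 0 <= r -> r <= 1 -> gauge_le U (n%:R * (`|z - 1| * C)) (D r).
  move=> r0 r1; have [rE|rn0] := eqVneq r 0.
    have -> : D r = 0.
      rewrite /D rE; under eq_bigr do rewrite mul0r.
      rewrite -scaler_suml -[RHS](scale0r (res b 0 * b * res b 0)).
      congr (_ *: _); rewrite -[RHS](@sum_zetaX R n 1) //.
      by apply: eq_bigr => k _; rewrite muln1.
    apply: (@gauge_le_le _ _ _ 0) => //; last exact: gauge_le0.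
    by rewrite !mulr_ge0 // ler0n.
  have z1 : z - 1 != 0.
    by rewrite subr_eq0 -[z]expr1; apply: zetaX_neq1.
  have rz : r * (z - 1) != 0 by rewrite mulf_neq0.
  have zB k : r * z ^+ k.+1 - r * z ^+ k = r * (z - 1) * z ^+ k.
    by rewrite exprS mulrBr mulr1 mulrBl mulrA.
  pose F k := res b (r * z ^+ k.+1) - res b (r * z ^+ k) -
    (r * z ^+ k.+1 - r * z ^+ k) *: (res b (r * z ^+ k) * b * res b (r * z ^+ k)).
  have hF k : gauge_le U (`|r * (z - 1)| ^+ 2 * C) (F k).
    have -> : `|r * (z - 1)| = `|r * z ^+ k.+1 - r * z ^+ k|.
      by rewrite zB [RHS]normrM zk1 mulr1.
    by apply: step; apply: nz.
  have sF : \sum_(k < n) F k = - (r * (z - 1)) *: D r.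
    rewrite /F big_split /= -(big_mkord xpredT
      (fun k => res b (r * z ^+ k.+1) - res b (r * z ^+ k))) /=.
    rewrite (telescope_sumr (fun k => res b (r * z ^+ k))) // zetaXn expr0 subrr add0r.
    rewrite /D scaler_sumr; apply: eq_bigr => k _.
    by rewrite scalerA -scaleNr zB mulNr.
  have := gauge_leZ (- (r * (z - 1)))^-1 aU (gauge_le_sum n aU hF).
  rewrite sF scalerA mulVf ?oppr_eq0 // scale1r normfV normrN.
  apply: gauge_le_le => //.
  have -> : `|r * (z - 1)|^-1 * (n%:R * (`|r * (z - 1)| ^+ 2 * C)) =
      r * (n%:R * (`|z - 1| * C)).
    rewrite mulrCA expr2 -[_ * _ * C]mulrA mulKf ?normr_eq0 //.
    by rewrite normrM (ger0_norm r0) -!mulrA mulrCA.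
  by rewrite ler_piMl // !mulr_ge0 // ler0n.
(* The change between the circles of radii [r] and [r']. *)
have hS r r' : 0 <= r -> r <= 1 -> 0 <= r' -> r' <= 1 ->
    gauge_le U (n%:R * (C * (`|r' - r| ^+ 2 + `|r' - r| * `|z - 1|))) (S r' - S r).
  move=> r0 r1 r0' r1'.
  pose F k := res b (r' * z ^+ k) - res b (r * z ^+ k) -
    (r' * z ^+ k - r * z ^+ k) *: (res b (r * z ^+ k) * b * res b (r * z ^+ k)).
  have hF k : gauge_le U (`|r' - r| ^+ 2 * C) (F k).
    have -> : `|r' - r| = `|r' * z ^+ k - r * z ^+ k|.
      by rewrite -mulrBl [RHS]normrM zk1 mulr1.
    by apply: step; apply: nz.
  have -> : S r' - S r = \sum_(k < n) F k + (r' - r) *: D r.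
    rewrite /S /D scaler_sumr -sumrB -big_split; apply: eq_bigr => k _ /=.
    by rewrite scalerA mulrBl subrK.
  have -> : n%:R * (C * (`|r' - r| ^+ 2 + `|r' - r| * `|z - 1|)) =
    n%:R * (`|r' - r| ^+ 2 * C) + `|r' - r| * (n%:R * (`|z - 1| * C)) by ring.
  by apply: gauge_leD => //; [exact: (gauge_le_sum n)|apply: gauge_leZ => //; exact: hD].
have hj j : (j <= n)%N ->
    gauge_le U (j%:R * (C * (n%:R^-1 + `|z - 1|))) (S (j%:R / n%:R) - S 0).
  elim: j => [|j IH] jn; first by rewrite !mul0r subrr; apply: gauge_le0.
  have jr (i : nat) : (i <= n)%N -> 0 <= (i%:R / n%:R : R[i]) /\ i%:R / n%:R <= 1 :> R[i].
    by move=> lin; rewrite divr_ge0 ?ler0n // ler_pdivrMr // mul1r ler_nat.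
  have [a1 a2] := jr _ jn; have [b1 b2] := jr _ (ltnW jn).
  rewrite -[S (j.+1%:R / _)](subrK (S (j%:R / n%:R))) -addrA -natr1 mulrDl mul1r.
  rewrite [j%:R * _ + _]addrC.
  apply: gauge_leD => //; last exact: IH (ltnW jn).
  have := hS _ _ b1 b2 a1 a2; rewrite -mulrBl -natr1 addrAC subrr add0r mul1r natr1.
  suff -> : n%:R * (C * (`|n%:R^-1| ^+ 2 + `|n%:R^-1| * `|z - 1|)) =
    C * (n%:R^-1 + `|z - 1|) by [].
  rewrite ger0_norm ?invr_ge0 ?ler0n // expr2 -mulrDr mulrCA mulVKf //.
  by rewrite gt_eqF.
have := hj n (leqnn n); rewrite divff ?gt_eqF //.
suff -> : S 1 - S 0 = \sum_(k < n) res b (z ^+ k) - n%:R by [].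
congr (_ - _); first by apply: eq_bigr => k _; rewrite mul1r.
rewrite /S (eq_bigr (fun=> 1)) ?sumr_const ?card_ord // => k _.
by rewrite /res mul0r scale0r subr0 invr1.
Qed.

End PowersVanish.

Section SmallPowers.
Variables (R : realType) (A : ciaType R[i]).
Implicit Types (U V W : set A) (x y a b : A) (c d e l m : R[i]).

Lemma comm_res b l : GRing.comm b (res b l).
Proof.
apply/commrV/commrB; first exact: commr1.
by rewrite /GRing.comm -scalerAr -scalerAl.
Qed.

(** The mean [g] of the resolvent over the [n]-th roots of unity is the inverse of
    [1 - b ^ n]; it tends to [1], so by continuity of inversion [b ^ n] tends to [0]. *)
Lemma powers_vanish b : (forall l, `|l| <= 2 -> 1 - l *: b \is a GRing.unit) ->
  vanishing (fun n => b ^+ n).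
Proof.
move=> ub U aU.
have ub1 l : `|l| <= 1 -> 1 - l *: b \is a GRing.unit.
  by move=> l1; apply/ub/(le_trans l1); rewrite ler1n.
have := Pilot.Defs.inv_continuous 1 (unitr1 A).
move=> /(_ _ (nbhs_gauge_le (1^-1 : A) aU (ltr01 : 0 < 1 :> R[i]))).
move=> /nbhs_absconvex[V aV hV].
have [C hC] : exists C, forall p : {l : R[i] | `|l| <= 1} * {l : R[i] | `|l| <= 1},
    gauge_le V C (res b (sval p.1) * b * (res b (sval p.1) * b * res b (sval p.2))).
  have bl := res_bounded ub.
  have blb : bounded_family (fun l : {l : R[i] | `|l| <= 1} => res b (sval l) * b).
    exact (bounded_comp (fun l : {l : R[i] | `|l| <= 1} => (l, tt))
      (bounded_mul bl (bounded_const unit b))).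
  exact: (bounded_comp (fun p : {l : R[i] | `|l| <= 1} * {l : R[i] | `|l| <= 1} =>
    (p.1, p)) (bounded_mul blb (bounded_mul blb bl))).
have C0 : 0 <= C.
  have z0 : `|0 : R[i]| <= 1 by rewrite normr0.
  by case: (hC (exist _ 0 z0, exist _ 0 z0)).
have e0 : 0 < (C + 1)^-1 / 2 by rewrite divr_gt0 ?invr_gt0 ?ltr_wpDl.
have [N1 hN1] := zeta_near1 e0.
have [N2 hN2] : exists N2 : nat, (C + 1) * 2 <= N2%:R.
  by apply: complex_nat_bound; rewrite mulr_ge0 // addr_ge0.
exists (maxn 2 (maxn N1 N2)) => n; rewrite !geq_max => /andP[n2 /andP[n1 nN2]].
have n0 : 0 < n%:R :> R[i] by rewrite ltr0n ltnW.
have hs := @sum_res_near _ _ b n V C n2 aV C0 ub1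
  (fun l m hl hm => hC (exist _ l hl, exist _ m hm)).
pose g := n%:R^-1 *: \sum_(k < n) res b (zeta R n ^+ k).
have nE : n%:R^-1 *: n%:R = 1 :> A.
  by rewrite -(scaler_nat n (1 : A)) scalerA mulVf ?scale1r ?gt_eqF.
have gE : g * (1 - b ^+ n) = 1.
  rewrite /g -scalerAl sum_res; last by move=> k; apply: ub1; rewrite norm_zetaX.
  by rewrite nE.
have cg : GRing.comm (1 - b ^+ n) g.
  rewrite /GRing.comm /g -scalerAl -scalerAr; congr (_ *: _).
  apply: commr_sum => k _; apply: commr_sym; apply: commrB; first exact: commr1.
  by apply: commrX; apply: commr_sym; apply: comm_res.
have gE' : (1 - b ^+ n) * g = 1 by rewrite cg.
have gu : g \is a GRing.unit by apply/unitrP; exists (1 - b ^+ n).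
have gV : g^-1 = 1 - b ^+ n by apply: (mulrI gu); rewrite mulrV // gE.
have : V (g - 1).
  apply/gauge_le_mem => //.
  have -> : g - 1 = n%:R^-1 *: (\sum_(k < n) res b (zeta R n ^+ k) - n%:R).
    by rewrite scalerBr nE.
  apply: gauge_le_le (gauge_leZ n%:R^-1 aV hs) => //.
  rewrite ger0_norm ?invr_ge0 ?ler0n // mulKf ?gt_eqF //.
  rewrite (@le_trans _ _ (C * (C + 1)^-1)) //; last first.
    by rewrite ler_pdivrMr ?ltr_wpDl // mul1r lerDl.
  rewrite ler_wpM2l // [leRHS]splitr lerD ?hN1 //.
  rewrite -invfM lef_pV2 ?posrE ?mulr_gt0 ?ltr_wpDl //.
  by apply: le_trans hN2 _; rewrite ler_nat.
move/hV; rewrite /= gV invr1 addrC addrA addNr add0r => h.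
by apply/gauge_le_mem => //; rewrite -[b ^+ n]opprK; apply: gauge_leN.
Qed.

Lemma small_powers_vanish : exists2 U, absconvex_nbhs U &
  forall b, gauge_le U 2^-1 b -> vanishing (fun n => b ^+ n).
Proof.
have u1 : nbhs (1 : A) [set x : A | x \is a GRing.unit].
  by apply: open_nbhs_nbhs; split; [exact: Pilot.Defs.open_unit|exact: unitr1].
have [U aU hU] := nbhs_absconvex u1.
exists U => // b hb; apply: powers_vanish => l l2; apply: hU.
rewrite addrC addrA addNr add0r; apply/gauge_le_mem/gauge_leN => //.
apply: gauge_le_le (gauge_leZ l aU hb) => //.
by rewrite ler_pdivrMr // mul1r.
Qed.

Lemma vanishing_bounded (w : nat -> A) : vanishing w -> bounded_family w.
Proof.
move=> hw U aU; have [N hN] := hw U aU.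
suff [c c0 hc] : exists2 c, 0 <= c & forall n, (n < N)%N -> gauge_le U c (w n).
  exists (c + 1) => n; have [nN|Nn] := ltnP n N.
    by apply: gauge_le_le (hc n nN) => //; rewrite lerDl.
  by apply: (@gauge_le_le _ _ _ 1) => //; [rewrite lerDr|apply/gauge_le_mem/hN].
elim: N {hN} => [|N [c c0 hc]]; first by exists 0.
have [d hd] := gauge_le_ex (w N) aU; have d0 : 0 <= d by case: hd.
exists (c + d); first exact: addr_ge0.
move=> n; rewrite ltnS leq_eqVlt => /orP[/eqP ->|/hc].
  by apply: gauge_le_le hd => //; rewrite lerDr.
by apply: gauge_le_le => //; rewrite lerDl.
Qed.

Lemma powers_exp_bounded a :
  exists2 r, 0 < r & bounded_family (fun n => (r ^+ n) *: a ^+ n).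
Proof.
have [U aU hU] := small_powers_vanish; have [c hc] := gauge_le_ex a aU.
have c0 : 0 <= c by case: hc.
have r0 : 0 < ((c + 1) * 2)^-1 by rewrite invr_gt0 mulr_gt0 // ltr_wpDl.
exists ((c + 1) * 2)^-1 => //.
suff : vanishing (fun n => (((c + 1) * 2)^-1 *: a) ^+ n).
  move/vanishing_bounded; congr bounded_family; apply/funext => n.
  by rewrite exprZn.
apply: hU; apply: gauge_le_le (gauge_leZ _ aU hc) => //.
rewrite gtr0_norm // invfM mulrAC ler_piMl ?invr_ge0 //.
by rewrite mulrC ler_pdivrMr ?ltr_wpDl // mul1r lerDl.
Qed.

End SmallPowers.
Arguments powers_vanish {R A b} _.
Arguments vanishing_bounded {R A w} _.

(** * The Jacobson radical of a subalgebra *)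

Section Subalgebra.
Variables (R : realType) (A : ciaType R[i]) (B : set A).
Hypothesis hB : unital_subalgebra B.
Implicit Types (x y z a b c u : A).

Lemma subalg0 : B 0. Proof. by case: hB => -[]. Qed.

Lemma subalg1 : B 1. Proof. by case: hB. Qed.

Lemma subalgM x y : B x -> B y -> B (x * y).
Proof. by case: hB => _ _; apply. Qed.

Lemma subalgZ (l : R[i]) x : B x -> B (l *: x).
Proof.
move=> Bx; rewrite -[_ *: _]addr0; case: hB => -[B0 h] _ _; exact: h.
Qed.

Lemma subalgD x y : B x -> B y -> B (x + y).
Proof.
by move=> Bx By; rewrite -[x]scale1r; case: hB => -[B0 h] _ _; apply: h.
Qed.

Lemma subalgN x : B x -> B (- x).
Proof. by rewrite -scaleN1r; apply: subalgZ. Qed.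

Lemma subalgB x y : B x -> B y -> B (x - y).
Proof. by move=> Bx By; apply: subalgD => //; apply: subalgN. Qed.

Lemma subalgX x n : B x -> B (x ^+ n).
Proof.
move=> Bx; elim: n => [|n IH]; first exact: subalg1.
by rewrite exprS; apply: subalgM.
Qed.

Lemma subalg_sum (I : Type) (r : seq I) (P : pred I) (F : I -> A) :
  (forall i, P i -> B (F i)) -> B (\sum_(i <- r | P i) F i).
Proof.
move=> hF; elim/big_rec: _ => [|i x Pi hx]; first exact: subalg0.
by apply: subalgD => //; apply: hF.
Qed.

Lemma unit_in1 : unit_in B 1.
Proof. by split; [exact: subalg1|exists 1; [exact: subalg1|rewrite mulr1]]. Qed.

Lemma unit_inM x y : unit_in B x -> unit_in B y -> unit_in B (x * y).
Proof.
move=> [Bx [x' Bx' [xx' x'x]]] [By [y' By' [yy' y'y]]].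
split; first exact: subalgM; exists (y' * x'); first exact: subalgM.
by rewrite mulrA -(mulrA x) yy' mulr1 mulrA -(mulrA y') x'x mulr1.
Qed.

Lemma unit_in_inverses x y z : B x -> B y -> B z -> x * y = 1 -> z * x = 1 ->
  unit_in B x.
Proof.
move=> Bx By Bz xy zx; split=> //; exists y => //; split=> //.
by rewrite -[y]mul1r -zx -mulrA xy mulr1.
Qed.

(** If [z] is the inverse of [1 - x y], then [1 + y z x] is the inverse of [1 - y x]. *)
Lemma unit_in_subC x y : B x -> B y -> unit_in B (1 - x * y) ->
  unit_in B (1 - y * x).
Proof.
move=> Bx By [_ [z Bz [h1 h2]]].
have Bw : B (1 + y * z * x).
  by apply: subalgD; [exact: subalg1|do 2?apply: subalgM].
have e1 : x * y * z = z - 1 by rewrite -h1 mulrBl mul1r opprB addrC subrK.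
have e2 : z * (x * y) = z - 1 by rewrite -h2 mulrBr mulr1 opprB addrC subrK.
apply: (@unit_in_inverses _ (1 + y * z * x) (1 + y * z * x)) => //.
- by apply: subalgB; [exact: subalg1|exact: subalgM].
- rewrite mulrBl mul1r mulrDr mulr1 -!mulrA (mulrA x) (mulrA (x * y)) e1.
  by rewrite mulrBl mul1r mulrBr [y * x + _]addrC subrK addrK.
- rewrite mulrBr mulr1 mulrDl mul1r -!mulrA (mulrA x y x) (mulrA z) e2.
  by rewrite mulrBl mul1r mulrBr [y * x + _]addrC subrK addrK.
Qed.

(** [1 - x] divides [1 - x ^ n]. *)
Lemma unit_in_subX x n : B x -> unit_in B (1 - x ^+ n) -> unit_in B (1 - x).
Proof.
move=> Bx [_ [y By [h1 h2]]]; set s := \sum_(i < n) x ^+ i.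
have Bs : B s by apply: subalg_sum => i _; apply: subalgX.
have e1 : 1 - x ^+ n = (1 - x) * s by rewrite -opprB subrX1 -mulNr opprB.
have e2 : 1 - x ^+ n = s * (1 - x).
  rewrite e1; apply: commr_sum => i _; apply: commr_sym.
  by apply: commrB; [exact: commr1|apply: commr_sym; apply: commrX].
apply: (@unit_in_inverses _ (s * y) (y * s)).
- by apply: subalgB => //; exact: subalg1.
- exact: subalgM.
- exact: subalgM.
- by rewrite mulrA -e1.
- by rewrite -mulrA -e2.
Qed.

Local Notation J := (jacobson_rad B).

Lemma rad_sub a : J a -> B a. Proof. by case. Qed.

Lemma radMr a b : J a -> B b -> J (a * b).
Proof.
move=> [Ba ha] Bb; split; first exact: subalgM.
by move=> c Bc; rewrite -mulrA; apply/ha/subalgM.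
Qed.

Lemma radMl a b : J a -> B b -> J (b * a).
Proof.
move=> [Ba ha] Bb; split; first exact: subalgM.
move=> c Bc; rewrite -mulrA; apply: unit_in_subC => //; first exact: subalgM.
by rewrite -mulrA; apply/ha/subalgM.
Qed.

Lemma rad_unit1 a : J a -> unit_in B (1 - a).
Proof. by move=> [_ /(_ 1 subalg1)]; rewrite mulr1. Qed.

Lemma rad_unit u a : unit_in B u -> J a -> unit_in B (u - a).
Proof.
move=> [Bu [v Bv [uv vu]]] Ja.
have -> : u - a = u * (1 - v * a) by rewrite mulrBr mulr1 mulrA uv mul1r.
apply: unit_inM; first by split=> //; exists v.
exact/rad_unit1/radMl.
Qed.

Lemma rad0 : J 0.
Proof. by split=> [|b _]; rewrite ?mul0r ?subr0; [exact: subalg0|exact: unit_in1]. Qed.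

Lemma radZ (l : R[i]) a : J a -> J (l *: a).
Proof.
move=> Ja; rewrite -mulr_algl; apply: radMl => //.
by apply: subalgZ; apply: subalg1.
Qed.

Lemma radN a : J a -> J (- a). Proof. by rewrite -scaleN1r; apply: radZ. Qed.

Lemma radD a b : J a -> J b -> J (a + b).
Proof.
move=> Ja Jb; split; first by apply: subalgD; apply: rad_sub.
move=> c Bc; rewrite mulrDl opprD addrA; apply: rad_unit; last exact: radMr.
by case: Ja => _; apply.
Qed.

Lemma rad_not1 : ~ J 1.
Proof.
move=> /rad_unit1; rewrite subrr => -[_ [y _ [/eqP]]].
by rewrite mul0r eq_sym oner_eq0.
Qed.

Lemma rad_of_powers c : B c ->
  (forall b, B b -> exists n, unit_in B (1 - (b * c) ^+ n)) -> J c.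
Proof.
move=> Bc hc; split=> // b Bb; apply: unit_in_subC => //.
have [n] := hc b Bb; apply: unit_in_subX; exact: subalgM.
Qed.

End Subalgebra.

Section ClosedSubalgebra.
Variables (R : realType) (A : ciaType R[i]).
Implicit Types (x y z a b c u : A) (U V : set A).

Lemma unit_inT x : unit_in setT x <-> x \is a GRing.unit.
Proof.
split; first by move=> [_ [y _ [xy yx]]]; apply/unitrP; exists y.
by move=> ux; split=> //; exists x^-1; rewrite // mulrV // mulVr.
Qed.

Lemma absconvex_gauge_le U (e : R[i]) : absconvex_nbhs U -> 0 < e ->
  absconvex_nbhs [set x | gauge_le U e x].
Proof.
move=> aU e0; split.
  by apply: filterS (nbhs_gauge_le 0 aU e0) => x; rewrite /= subr0.
move=> a b x y ab hx hy /=; apply: (@gauge_le_le _ _ _ (`|a| * e + `|b| * e)) => //.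
  by rewrite -mulrDl ler_piMl // ltW.
by apply: gauge_leD => //; apply: gauge_leZ.
Qed.

Lemma vanishing_gauge_le (w : nat -> A) U (e : R[i]) : vanishing w ->
  absconvex_nbhs U -> 0 < e ->
  exists N, forall n, (N <= n)%N -> gauge_le U e (w n).
Proof. by move=> hw aU e0; apply: (hw _ (absconvex_gauge_le aU e0)). Qed.

Lemma vanishing_mull c (w : nat -> A) : vanishing w ->
  vanishing (fun n => c * w n).
Proof.
move=> hw U aU; have [V aV VU] := gauge_leM aU.
have [d hd] := gauge_le_ex c aV; have d0 : 0 <= d by case: hd.
have e0 : 0 < (d + 1)^-1 by rewrite invr_gt0 ltr_wpDl.
have [N hN] := vanishing_gauge_le hw aV e0.
exists N => n /hN h; apply/gauge_le_mem => //.
apply: gauge_le_le (VU _ _ _ _ hd h) => //.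
by rewrite ler_pdivrMr ?ltr_wpDl // mul1r lerDl.
Qed.

Lemma closed_vanishing (B : set A) x (w : nat -> A) : closed B ->
  vanishing w -> (forall n, B (x - w n)) -> B x.
Proof.
move=> cB hw hx; apply: cB => W /nbhs_absconvex[U aU UW].
have [N hN] := hw U aU; exists (x - w N); split; first exact: hx.
apply: UW; rewrite addrAC subrr add0r; apply/gauge_le_mem/gauge_leN => //.
by apply/gauge_le_mem => //; apply: hN.
Qed.

Lemma vanishing_unit b : vanishing (fun n => b ^+ n) -> 1 - b \is a GRing.unit.
Proof.
move=> hb.
have u1 : nbhs (1 : A) [set x : A | x \is a GRing.unit].
  by apply: open_nbhs_nbhs; split; [exact: Pilot.Defs.open_unit|exact: unitr1].
have [U aU hU] := nbhs_absconvex u1.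
have [N hN] := hb U aU.
have hT : unital_subalgebra (@setT A) by split.
apply/unit_inT/(unit_in_subX hT (n := N)) => //; apply/unit_inT/hU.
rewrite addrC addrA addNr add0r; apply/gauge_le_mem/gauge_leN => //.
by apply/gauge_le_mem => //; apply: hN.
Qed.

Variable B : set A.
Hypothesis hB : unital_subalgebra B.
Hypothesis cB : closed B.

(** The inverse of [1 - b] in the whole algebra is the sum of the Neumann series, so it
    lies in the closed subalgebra [B]. *)
Lemma vanishing_unit_in b : B b -> vanishing (fun n => b ^+ n) ->
  unit_in B (1 - b).
Proof.
move=> Bb hb; have ub := vanishing_unit hb.
have Bi : B (1 - b)^-1.
  apply: (closed_vanishing cB (vanishing_mull (1 - b)^-1 hb)) => n.
  have -> : (1 - b)^-1 - (1 - b)^-1 * b ^+ n = \sum_(i < n) b ^+ i.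
    rewrite -{1}[(1 - b)^-1]mulr1 -mulrBr -[1 - b ^+ n]opprB subrX1 -mulNr opprB.
    by rewrite mulrA mulVr // mul1r.
  by apply: (subalg_sum hB) => i _; apply: (subalgX hB).
split; first by apply: (subalgB hB) => //; exact: (subalg1 hB).
by exists (1 - b)^-1 => //; rewrite mulrV // mulVr.
Qed.

(** If [c] in the radical is close to [a], then [1 - (a - c) b] is invertible in [B], and
    [1 - a b] differs from it by the element [c b] of the radical. *)
Lemma closed_rad : closed (jacobson_rad B).
Proof.
have sub : jacobson_rad B `<=` B by move=> a [].
move=> a ha; have Ba : B a by apply: cB; apply: closureS ha.
split=> // b Bb.
have [U aU hU] := small_powers_vanish A.
have [V aV VU] := gauge_leM aU.
have [d hd] := gauge_le_ex b aV; have d0 : 0 <= d by case: hd.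
have e0 : 0 < ((d + 1) * 2)^-1 by rewrite invr_gt0 mulr_gt0 // ltr_wpDl.
have [c [Jc /= hc]] := ha _ (nbhs_gauge_le a aV e0).
have Bac : B ((a - c) * b).
  by apply: (subalgM hB) => //; apply: (subalgB hB) => //; apply: sub.
have -> : 1 - a * b = 1 - (a - c) * b - c * b.
  by rewrite mulrBl opprB addrA addrAC addrK.
apply: (rad_unit hB); last exact: (radMr hB).
apply: vanishing_unit_in => //; apply: hU.
rewrite -opprB mulNr; apply: gauge_leN => //.
apply: gauge_le_le (VU _ _ _ _ hc hd) => //.
rewrite mulrC invfM mulrA ler_piMl ?invr_ge0 //.
by rewrite ler_pdivrMr ?ltr_wpDl // mul1r lerDl.
Qed.

End ClosedSubalgebra.
Arguments closed_rad {R A B} _ _.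

(** * Exponential growth rates *)

Lemma expn_le_fact k n : (0 < k)%N -> (k ^ n <= k ^ k * n`!)%N.
Proof.
move=> k0; elim: n => [|n IH]; first by rewrite expn0 fact0 muln1 expn_gt0 k0.
have [kn|nk] := leqP k n.+1.
  by rewrite expnS factS mulnCA leq_mul.
apply: leq_trans (leq_pmulr _ (fact_gt0 _)).
by rewrite leq_pexp2l // ltnW.
Qed.

Lemma exp_le_fact (R : realType) (t : R[i]) : 0 <= t ->
  exists2 M : R[i], 0 <= M & forall n, t ^+ n / n`!%:R <= M.
Proof.
move=> t0; have [k hk] := complex_nat_bound t0.
have tk : t <= k.+1%:R by rewrite (le_trans hk) // ler_nat.
exists (k.+1 ^ k.+1)%:R; rewrite ?ler0n // => n.
rewrite ler_pdivrMr ?ltr0n ?fact_gt0 // -natrM.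
apply: (@le_trans _ _ (k.+1%:R ^+ n)); first by rewrite lerXn2r ?nnegrE ?ler0n.
by rewrite -natrX ler_nat expn_le_fact.
Qed.

Section ExponentialRates.
Variables (R : realType) (A : ciaType R[i]).
Implicit Types (U V : set A) (x y b : A) (r s : R[i]) (u v w : nat -> A).

(** The sequence is bounded by a multiple of [r ^ -n], in every gauge. *)
Definition exp_bounded r w : Prop := bounded_family (fun n => r ^+ n *: w n).

(** The sequence decays faster than every exponential. *)
Definition superexp w : Prop := forall r, 0 < r -> exp_bounded r w.

Lemma exp_bounded2_vanishing w : exp_bounded 2 w -> vanishing w.
Proof.
move=> hw U aU; have [c hc] := hw U aU.
have [k hk] := complex_nat_bound (hc 0%N).1.
exists k => n kn; apply/gauge_le_mem => //.
have -> : w n = (2 ^+ n)^-1 *: (2 ^+ n *: w n).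
  by rewrite scalerA mulVf ?scale1r // expf_neq0 // pnatr_eq0.
have p2 : 0 < 2 ^+ n :> R[i] by rewrite exprn_gt0.
apply: gauge_le_le (gauge_leZ _ aU (hc n)) => //.
rewrite gtr0_norm ?invr_gt0 // mulrC ler_pdivrMr // mul1r.
rewrite (le_trans hk) // -natrX ler_nat (leq_trans kn) //.
exact/ltnW/ltn_expl.
Qed.

Lemma exp_bounded_mul r s v w : exp_bounded r v -> exp_bounded s w ->
  exp_bounded (r * s) (fun n => v n * w n).
Proof.
move=> hv hw U aU; have [c hc] := bounded_mul hv hw U aU.
exists c => n; have := hc (n, n); rewrite /= -scalerAl -scalerAr scalerA.
by rewrite exprMn.
Qed.

Lemma superexp_vanishing b w : superexp w -> vanishing (fun n => b ^+ n * w n).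
Proof.
move=> hw; have [r r0 hr] := powers_exp_bounded b.
apply: exp_bounded2_vanishing.
have r2 : 0 < 2 / r by rewrite divr_gt0.
have := exp_bounded_mul hr (hw _ r2).
by rewrite mulrC divfK ?gt_eqF.
Qed.

(** The sequence that lifts the powers of a sum of two commuting elements. *)
Lemma superexp_conv v w : superexp v -> superexp w ->
  superexp (fun n => \sum_(i < n.+1) (v (n - i)%N * w i) *+ 'C(n, i)).
Proof.
move=> hv hw r r0 U aU.
have r2 : 0 < r * 2 by rewrite mulr_gt0.
have [c hc] := bounded_mul (hv _ r2) (hw _ r2) U aU.
have p2 n : 0 < 2 ^+ n :> R[i] by rewrite exprn_gt0.
exists c => n.
have -> : r ^+ n *: \sum_(i < n.+1) v (n - i)%N * w i *+ 'C(n, i) =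
    (2 ^+ n)^-1 *: \sum_(i < n.+1) 'C(n, i)%:R *:
      (((r * 2) ^+ (n - i) *: v (n - i)%N) * ((r * 2) ^+ i *: w i)).
  rewrite !scaler_sumr; apply: eq_bigr => i _.
  rewrite -scalerAl -scalerAr !scalerA -scaler_nat scalerA; congr (_ *: _).
  have lin : (i <= n)%N by rewrite -ltnS.
  have -> : r ^+ n = (2 ^+ n)^-1 * ((r * 2) ^+ (n - i) * (r * 2) ^+ i).
    by rewrite -exprD subnK // exprMn mulrCA mulVf ?mulr1 // gt_eqF.
  move: ((r * 2) ^+ (n - i)) ((r * 2) ^+ i) (2 ^+ n)^-1 ('C(n, i)%:R : R[i]).
  by move=> p q h d; ring.
have := gauge_leZ (2 ^+ n)^-1 aU (gauge_le_bigsum (index_enum 'I_n.+1) aU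
  (fun i : 'I_n.+1 => gauge_leZ ('C(n, i)%:R : R[i]) aU (hc ((n - i)%N, i : nat)))).
rewrite -mulr_suml gtr0_norm ?invr_gt0 //.
rewrite (eq_bigr (fun i : 'I_n.+1 => 'C(n, i)%:R)); last first.
  by move=> i _; rewrite ger0_norm ?ler0n.
have -> : \sum_(i < n.+1) 'C(n, i)%:R = 2 ^+ n :> R[i].
  rewrite (_ : 2 = 1 + 1) // exprDn; apply: eq_bigr => i _.
  by rewrite !expr1n mulr1.
by rewrite mulKf ?gt_eqF.
Qed.

Lemma iter_brk_gauge_le x y U (c : R[i]) (n a b : nat) : absconvex_nbhs U ->
  (forall i j, (i + j = n)%N -> gauge_le U c (x ^+ (a + i) * y * x ^+ (b + j))) ->
  gauge_le U (2 ^+ n * c) (x ^+ a * iter n (brk x) y * x ^+ b).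
Proof.
move=> aU; elim: n a b => [|n IH] a b h.
  by rewrite expr0 mul1r; have := h 0%N 0%N erefl; rewrite !addn0.
rewrite exprS mulr2n mulrDl mul1r mulrDl.
have -> : x ^+ a * iter n.+1 (brk x) y * x ^+ b =
    x ^+ a.+1 * iter n (brk x) y * x ^+ b - x ^+ a * iter n (brk x) y * x ^+ b.+1.
  by rewrite iterS {1}/brk mulrBr mulrBl exprSr exprS !mulrA.
apply: gauge_leD => //; last apply: gauge_leN => //; apply: IH => i j ij.
  by have := h i.+1 j; rewrite !addSn addnS ij; apply.
by have := h i j.+1; rewrite addSn !addnS ij; apply.
Qed.

(** Expanding [(ad x) ^ n (u n)] gives [2 ^ n] terms [x ^ i * u n * x ^ j], up to sign, with
    [i + j = n]. *)
Lemma iter_brk_exp_bounded x : exists2 r, 0 < r &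
  forall s u, 0 < s -> exp_bounded s u ->
    exp_bounded (r * s) (fun n => iter n (brk x) (u n)).
Proof.
have [r r0 hr] := powers_exp_bounded x.
exists (r / 2); first by rewrite divr_gt0.
move=> s u s0 hu U aU.
have [c hc] := bounded_mul (bounded_mul hr hu) hr U aU.
have rn n : r ^+ n != 0 by rewrite expf_neq0 ?gt_eqF.
have sn n : s ^+ n != 0 by rewrite expf_neq0 ?gt_eqF.
have p2 n : 2 ^+ n != 0 :> R[i] by rewrite expf_neq0 ?pnatr_eq0.
exists c => n.
have rs0 : 0 < r ^+ n * s ^+ n by rewrite mulr_gt0 ?exprn_gt0.
have h i j : (i + j = n)%N ->
    gauge_le U ((r ^+ n * s ^+ n)^-1 * c) (x ^+ (0 + i) * u n * x ^+ (0 + j)).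
  move=> ij; have := gauge_leZ (r ^+ n * s ^+ n)^-1 aU (hc ((i, n), j)).
  rewrite gtr0_norm ?invr_gt0 // !add0n /=.
  suff -> : (r ^+ n * s ^+ n)^-1 *:
    (r ^+ i *: x ^+ i * (s ^+ n *: u n) * (r ^+ j *: x ^+ j)) =
    x ^+ i * u n * x ^+ j by [].
  rewrite -scalerAl -scalerAr -scalerAl -scalerAr -scalerAl !scalerA.
  rewrite -[RHS]scale1r; congr (_ *: _); rewrite -ij exprD ij.
  move: (rn i) (rn j) (sn n); move: (r ^+ i) (r ^+ j) (s ^+ n) => p q h *.
  by field; apply/and3P.
have := gauge_leZ ((r / 2 * s) ^+ n) aU (iter_brk_gauge_le aU h).
rewrite !expr0 mul1r mulr1 ger0_norm; last first.
  by rewrite exprn_ge0 // mulr_ge0 ?divr_ge0 ?ltW.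
suff -> : (r / 2 * s) ^+ n * (2 ^+ n * ((r ^+ n * s ^+ n)^-1 * c)) = c by [].
rewrite !exprMn exprVn; move: (rn n) (sn n) (p2 n).
move: (r ^+ n) (s ^+ n) (2 ^+ n) => p q d p0 q0 d0; field.
by rewrite p0 q0 d0.
Qed.

Lemma superexp_brk x y :
  superexp (fun n => (n`!%:R : R[i])^-1 *: iter n (brk x) (y ^+ n)).
Proof.
have [s s0 hs] := powers_exp_bounded y.
have [r r0 hr] := iter_brk_exp_bounded x.
move=> t t0 U aU; have [c hc] := hr s _ s0 hs U aU.
have c0 : 0 <= c := (hc 0%N).1.
have rs0 : 0 < r * s by rewrite mulr_gt0.
have q0 : 0 <= t / (r * s) by rewrite divr_ge0 ?ltW.
have [M M0 hM] := exp_le_fact q0.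
exists (M * c) => n.
have -> : t ^+ n *: ((n`!%:R)^-1 *: iter n (brk x) (y ^+ n)) =
    ((t / (r * s)) ^+ n / n`!%:R) *: ((r * s) ^+ n *: iter n (brk x) (y ^+ n)).
  rewrite !scalerA; congr (_ *: _).
  by rewrite mulrAC exprMn exprVn divfK // expf_neq0 // gt_eqF.
apply: gauge_le_le (gauge_leZ _ aU (hc n)) => //.
rewrite ger0_norm ?divr_ge0 ?exprn_ge0 ?ler0n //.
exact: ler_wpM2r.
Qed.

Lemma iter_brk_vanishing x : exists2 C : R[i], 0 <= C &
  forall (k : R[i]) y, C <= `|k| -> vanishing (fun n => k ^- n *: iter n (brk x) y).
Proof.
have [r r0 hr] := iter_brk_exp_bounded x.
exists (2 / r); first by rewrite divr_ge0 ?ltW.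
move=> k y hk; apply: exp_bounded2_vanishing => U aU.
have h1 : exp_bounded 1 (fun=> y).
  move=> V aV; have [c hc] := gauge_le_ex y aV; exists c => n.
  by rewrite expr1n scale1r.
have [c hc] := hr 1 _ ltr01 h1 U aU; exists c => n.
have c0 : 0 <= c := (hc 0%N).1.
have k0 : 0 < `|k| by rewrite (lt_le_trans _ hk) // divr_gt0.
have -> : 2 ^+ n *: (k ^- n *: iter n (brk x) y) =
    (2 / (k * r)) ^+ n *: ((r * 1) ^+ n *: iter n (brk x) y).
  rewrite !scalerA; congr (_ *: _); rewrite mulr1 exprMn exprVn exprMn invfM -mulrA.
  by rewrite divfK // expf_neq0 // gt_eqF.
apply: gauge_le_le (gauge_leZ _ aU (hc n)) => //.
rewrite ler_piMl // normrX exprn_ile1 // normrM normfV normrM normr_nat (gtr0_norm r0).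
by rewrite ler_pdivrMr ?mulr_gt0 // mul1r -ler_pdivrMr.
Qed.

End ExponentialRates.
Arguments exp_bounded2_vanishing {R A w} _.
Arguments exp_bounded_mul {R A r s v w} _ _.
Arguments superexp_vanishing {R A} b {w} _.
Arguments superexp_conv {R A v w} _ _.
Arguments superexp_brk {R A} x y.

(** * The quotient by the radical *)

(** A unital subalgebra, bundled so that it can index a type. *)
Record subalgebra (R : realType) (A : ciaType R[i]) := Subalgebra {
  subalgebra_set :> set A;
  subalgebraP : unital_subalgebra subalgebra_set
}.

Section RadicalQuotient.
Variables (R : realType) (A : ciaType R[i]) (S : subalgebra A).
Local Notation B := (subalgebra_set S).
Let hB := subalgebraP S.
Local Notation J := (jacobson_rad B).
Implicit Types (a b c : A).

(** A canonical representative of the class of [a] modulo the radical. *)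
Definition rad_repr a : A := choose (fun b => `[< J (a - b) >]) a.

Lemma rad_reprP a : J (a - rad_repr a).
Proof.
apply/asboolP; apply: (@chooseP _ (fun b => `[< J (a - b) >]) a).
by apply/asboolP; rewrite subrr; apply: rad0.
Qed.

Lemma rad_repr_eq a b : J (a - b) -> rad_repr a = rad_repr b.
Proof.
move=> Jab; rewrite /rad_repr.
have e : (fun c => `[< J (a - c) >]) =1 (fun c => `[< J (b - c) >]).
  move=> c; apply/asboolP/asboolP => h.
    rewrite -[b - c](subrKA a) -[b - a]opprB.
    by apply: (radD hB) => //; apply: (radN hB).
  by rewrite -[a - c](subrKA b); apply: (radD hB).
rewrite (eq_choose e); apply: choose_id; apply/asboolP.
  by rewrite -opprB; apply: (radN hB).
by rewrite subrr; apply: rad0.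
Qed.

Lemma subalg_rad_repr a : B a -> B (rad_repr a).
Proof.
move=> Ba; rewrite -[rad_repr a](subKr a); apply: (subalgB hB) => //.
exact: rad_sub (rad_reprP a).
Qed.

Definition is_rad_repr a : bool := `[< B a >] && (rad_repr a == a).

(** The quotient algebra of the subalgebra by its radical, realised as the type of
    canonical representatives. *)
Definition rad_quotient := {a : A | is_rad_repr a}.

HB.instance Definition _ := Choice.on rad_quotient.

Implicit Types p q : rad_quotient.

Definition quot_lift q : A := val q.

Lemma quot_liftP q : B (quot_lift q).
Proof. by case/andP: (valP q) => /asboolP. Qed.

Fact quot_mk_subproof a : is_rad_repr (rad_repr (if `[< B a >] then a else 0)).
Proof.
have h c : B c -> is_rad_repr (rad_repr c).
  move=> Bc; apply/andP; split; first by apply/asboolP; apply: subalg_rad_repr.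
  by apply/eqP/esym/rad_repr_eq/rad_reprP.
by case: asboolP => [/h //|_]; apply: h; apply: subalg0.
Qed.

(** The projection onto the quotient.  It is defined on the whole algebra, with value zero
    outside the subalgebra. *)
Definition quot_mk a : rad_quotient := Sub _ (quot_mk_subproof a).

Lemma quot_liftK q : quot_mk (quot_lift q) = q.
Proof.
apply: val_inj; rewrite /= asboolT; last exact: quot_liftP.
by case/andP: (valP q) => _ /eqP.
Qed.

Lemma quot_mkP a b : B a -> B b -> quot_mk a = quot_mk b <-> J (a - b).
Proof.
move=> Ba Bb; split.
  move=> /(congr1 val) /=; rewrite !asboolT // => e.
  have -> : a - b = (a - rad_repr a) - (b - rad_repr b).
    by rewrite e opprB subrKA.
  by apply: (radD hB); [exact: rad_reprP|apply/(radN hB)/rad_reprP].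
by move=> Jab; apply: val_inj; rewrite /= !asboolT //; apply: rad_repr_eq.
Qed.

Lemma quot_mkK a : B a -> J (quot_lift (quot_mk a) - a).
Proof. by move=> Ba; apply/quot_mkP; rewrite ?quot_liftK //; apply: quot_liftP. Qed.

Definition quot_add p q := quot_mk (quot_lift p + quot_lift q).
Definition quot_opp p := quot_mk (- quot_lift p).
Definition quot_mul p q := quot_mk (quot_lift p * quot_lift q).
Definition quot_scale (l : R[i]) p := quot_mk (l *: quot_lift p).

Fact quot_addE a b : B a -> B b ->
  quot_add (quot_mk a) (quot_mk b) = quot_mk (a + b).
Proof.
move=> Ba Bb; apply/quot_mkP;
  do ?[exact: (subalgD hB) | apply: (subalgD hB); exact: quot_liftP].
rewrite opprD addrACA; apply: (radD hB); exact: quot_mkK.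
Qed.

Fact quot_oppE a : B a -> quot_opp (quot_mk a) = quot_mk (- a).
Proof.
move=> Ba; apply/quot_mkP; do ?[exact: (subalgN hB) | apply: (subalgN hB); exact: quot_liftP].
rewrite -opprD; apply: (radN hB); exact: quot_mkK.
Qed.

Fact quot_scaleE l a : B a -> quot_scale l (quot_mk a) = quot_mk (l *: a).
Proof.
move=> Ba; apply/quot_mkP; do ?[exact: (subalgZ hB) | apply: (subalgZ hB); exact: quot_liftP].
by rewrite -scalerBr; apply: (radZ hB); exact: quot_mkK.
Qed.

Fact quot_mulE a b : B a -> B b ->
  quot_mul (quot_mk a) (quot_mk b) = quot_mk (a * b).
Proof.
move=> Ba Bb; apply/quot_mkP;
  do ?[exact: (subalgM hB) | apply: (subalgM hB); exact: quot_liftP].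
rewrite -[X in J X](subrKA (a * quot_lift (quot_mk b))) -mulrBl -mulrBr.
apply: (radD hB).
  by apply: (radMr hB); [exact: quot_mkK|exact: quot_liftP].
by apply: (radMl hB) => //; exact: quot_mkK.
Qed.

Fact quot_ind (P : rad_quotient -> Prop) :
  (forall a, B a -> P (quot_mk a)) -> forall q, P q.
Proof. by move=> h q; rewrite -[q]quot_liftK; apply/h/quot_liftP. Qed.

Local Notation BD := (subalgD hB).
Local Notation BM := (subalgM hB).
Local Notation BZ := (subalgZ hB).
Local Notation BN := (subalgN hB).
Local Notation B0 := (subalg0 hB).
Local Notation B1 := (subalg1 hB).

Fact quot_addA : associative quot_add.
Proof.
elim/quot_ind => a Ba; elim/quot_ind => b Bb; elim/quot_ind => c Bc.
by rewrite !quot_addE ?addrA //; apply: BD.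
Qed.

Fact quot_addC : commutative quot_add.
Proof.
elim/quot_ind => a Ba; elim/quot_ind => b Bb; by rewrite !quot_addE // addrC.
Qed.

Fact quot_add0 : left_id (quot_mk 0) quot_add.
Proof.
elim/quot_ind => a Ba; rewrite quot_addE ?add0r //; exact: B0.
Qed.

Fact quot_addN : left_inverse (quot_mk 0) quot_opp quot_add.
Proof.
elim/quot_ind => a Ba; rewrite quot_oppE // quot_addE ?addNr //; exact: BN.
Qed.

HB.instance Definition _ := GRing.isZmodule.Build rad_quotient
  quot_addA quot_addC quot_add0 quot_addN.

Fact quot_mulA : associative quot_mul.
Proof.
elim/quot_ind => a Ba; elim/quot_ind => b Bb; elim/quot_ind => c Bc.
by rewrite !quot_mulE ?mulrA //; apply: BM.
Qed.

Fact quot_mul1 : left_id (quot_mk 1) quot_mul.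
Proof.
elim/quot_ind => a Ba; rewrite quot_mulE ?mul1r //; exact: B1.
Qed.

Fact quot_mulr1 : right_id (quot_mk 1) quot_mul.
Proof.
elim/quot_ind => a Ba; rewrite quot_mulE ?mulr1 //; exact: B1.
Qed.

Fact quot_mulDl : left_distributive quot_mul +%R.
Proof.
elim/quot_ind => a Ba; elim/quot_ind => b Bb; elim/quot_ind => c Bc.
rewrite [quot_mk a + _]quot_addE // !quot_mulE //; last exact: BD.
by rewrite [RHS]quot_addE ?mulrDl //; exact: BM.
Qed.

Fact quot_mulDr : right_distributive quot_mul +%R.
Proof.
elim/quot_ind => a Ba; elim/quot_ind => b Bb; elim/quot_ind => c Bc.
rewrite [quot_mk b + _]quot_addE // !quot_mulE //; last exact: BD.
by rewrite [RHS]quot_addE ?mulrDr //; exact: BM.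
Qed.

Fact quot_1neq0 : quot_mk 1 != 0.
Proof.
apply/eqP => /(quot_mkP B1 B0); rewrite subr0; exact: rad_not1.
Qed.

HB.instance Definition _ := GRing.Zmodule_isNzRing.Build rad_quotient
  quot_mulA quot_mul1 quot_mulr1 quot_mulDl quot_mulDr quot_1neq0.

Fact quot_scaleA l m q : quot_scale l (quot_scale m q) = quot_scale (l * m) q.
Proof.
by elim/quot_ind: q => a Ba; rewrite !quot_scaleE ?scalerA //; apply: BZ.
Qed.

Fact quot_scale1 : left_id 1 quot_scale.
Proof. by elim/quot_ind => a Ba; rewrite quot_scaleE // scale1r. Qed.

Fact quot_scaleDr : right_distributive quot_scale +%R.
Proof.
move=> l; elim/quot_ind => a Ba; elim/quot_ind => b Bb.
rewrite [quot_mk a + _]quot_addE // !quot_scaleE //; last exact: BD.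
by rewrite [RHS]quot_addE ?scalerDr //; exact: BZ.
Qed.

Fact quot_scaleDl q : {morph quot_scale^~ q : l m / l + m}.
Proof.
move=> l m; elim/quot_ind: q => a Ba; rewrite !quot_scaleE //.
by rewrite [RHS]quot_addE ?scalerDl //; exact: BZ.
Qed.

HB.instance Definition _ := GRing.Zmodule_isLmodule.Build R[i] rad_quotient
  quot_scaleA quot_scale1 quot_scaleDr quot_scaleDl.

Fact quot_scaleAl (l : R[i]) p q : l *: (p * q) = l *: p * q.
Proof.
elim/quot_ind: p => a Ba; elim/quot_ind: q => b Bb.
rewrite [X in _ *: X]quot_mulE // [LHS]quot_scaleE; last exact: BM.
rewrite [l *: quot_mk a]quot_scaleE // [RHS]quot_mulE ?scalerAl //; exact: BZ.
Qed.

HB.instance Definition _ := GRing.Lmodule_isLalgebra.Build R[i] rad_quotient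
  quot_scaleAl.

Fact quot_scaleAr (l : R[i]) p q : l *: (p * q) = p * (l *: q).
Proof.
elim/quot_ind: p => a Ba; elim/quot_ind: q => b Bb.
rewrite [X in _ *: X]quot_mulE // [LHS]quot_scaleE; last exact: BM.
rewrite [l *: quot_mk b]quot_scaleE // [RHS]quot_mulE ?scalerAr //; exact: BZ.
Qed.

HB.instance Definition _ := GRing.Lalgebra_isAlgebra.Build R[i] rad_quotient
  quot_scaleAr.

Lemma quot_mk0 : quot_mk 0 = 0. Proof. by []. Qed.

Lemma quot_mk1 : quot_mk 1 = 1. Proof. by []. Qed.

Lemma quot_mkD a b : B a -> B b -> quot_mk (a + b) = quot_mk a + quot_mk b.
Proof. by move=> Ba Bb; rewrite [RHS]quot_addE. Qed.

Lemma quot_mkN a : B a -> quot_mk (- a) = - quot_mk a.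
Proof. by move=> Ba; rewrite [RHS]quot_oppE. Qed.

Lemma quot_mkM a b : B a -> B b -> quot_mk (a * b) = quot_mk a * quot_mk b.
Proof. by move=> Ba Bb; rewrite [RHS]quot_mulE. Qed.

Lemma quot_mkZ (l : R[i]) a : B a -> quot_mk (l *: a) = l *: quot_mk a.
Proof. by move=> Ba; rewrite [RHS]quot_scaleE. Qed.

Lemma quot_mkB a b : B a -> B b -> quot_mk (a - b) = quot_mk a - quot_mk b.
Proof. by move=> Ba Bb; rewrite quot_mkD ?quot_mkN //; apply: BN. Qed.

Lemma quot_mkX a n : B a -> quot_mk (a ^+ n) = quot_mk a ^+ n.
Proof.
move=> Ba; elim: n => [|n IH]; first by rewrite !expr0.
by rewrite !exprS quot_mkM ?IH //; apply: (subalgX hB).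
Qed.

Lemma quot_mk_brk a b : B a -> B b -> quot_mk (brk a b) = brk (quot_mk a) (quot_mk b).
Proof. by move=> Ba Bb; rewrite /brk quot_mkB ?quot_mkM //; apply: BM. Qed.

Lemma quot_mk_sum (I : Type) (r : seq I) (F : I -> A) : (forall i, B (F i)) ->
  quot_mk (\sum_(i <- r) F i) = \sum_(i <- r) quot_mk (F i).
Proof.
move=> hF; elim: r => [|i r IH]; first by rewrite !big_nil.
rewrite !big_cons quot_mkD ?IH //; exact: (subalg_sum hB).
Qed.

Lemma quot_mk_eq0 a : B a -> quot_mk a = 0 <-> J a.
Proof. by move=> Ba; rewrite -quot_mk0 quot_mkP ?subr0 //; exact: B0. Qed.

End RadicalQuotient.

(** * The closed algebra generated by a set, modulo its radical *)

Section GeneratedAlgebra.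
Variables (R : realType) (A : ciaType R[i]) (g : set A).
Implicit Types (a b c x y z : A).

Fact generated_subalgebra : unital_subalgebra (closed_generated_algebra g).
Proof.
split.
- split; first by move=> X [[[[X0 _] _ _] _] _].
  move=> l x y hx hy X hX; case: (hX) => [[[[_ h] _ _] _] _].
  by apply: h; [exact: hx|exact: hy].
- by move=> X [[[_ X1 _] _] _].
- move=> x y hx hy X hX; case: (hX) => [[[_ _ h] _] _].
  by apply: h; [exact: hx|exact: hy].
Qed.

Lemma generated_closed : closed (closed_generated_algebra g).
Proof.
move=> a ha X hX; case: (hX) => [[_ cX] _]; apply: cX.
by apply: closureS ha => b; apply.
Qed.

Lemma generated_sub : g `<=` closed_generated_algebra g.
Proof. by move=> x gx X [_]; apply. Qed.

Definition generated := Subalgebra generated_subalgebra.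

Local Notation B := (closed_generated_algebra g).
Local Notation J := (jacobson_rad B).
Local Notation Q := (rad_quotient generated).
Local Notation pi := (@quot_mk R A generated).
Local Notation hB := generated_subalgebra.
Implicit Types (p q r u : Q).

Lemma lift_in q : B (quot_lift q). Proof. exact: (@quot_liftP _ _ generated q). Qed.

Lemma mk_eq0 a : B a -> pi a = 0 <-> J a.
Proof. exact: (@quot_mk_eq0 R A generated). Qed.

Lemma mulLR_small x y (U : set A) : absconvex_nbhs U ->
  exists2 V, absconvex_nbhs V & forall z, V z -> U (x * z * y).
Proof.
have small c (W : set A) : absconvex_nbhs W ->
    exists2 V, absconvex_nbhs V & forall z, V z -> W (c * z) /\ W (z * c).
  move=> aW; have [V aV VW] := gauge_leM aW.
  have [d hd] := gauge_le_ex c aV; have d0 : 0 <= d := hd.1.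
  have e0 : 0 < (d + 1)^-1 by rewrite invr_gt0 ltr_wpDl.
  have h : d / (d + 1) <= 1 by rewrite ler_pdivrMr ?ltr_wpDl // mul1r lerDl.
  exists [set z | gauge_le V (d + 1)^-1 z]; first exact: absconvex_gauge_le.
  move=> z /= hz; split; apply/gauge_le_mem => //.
    exact: gauge_le_le (VW _ _ _ _ hd hz).
  by apply: gauge_le_le (VW _ _ _ _ hz hd) => //; rewrite mulrC.
move=> aU; have [V aV hV] := small y U aU; have [W aW hW] := small x V aV.
by exists W => // z /hW[/hV[]].
Qed.

Lemma closed_rad_preimage (f : A -> A) : {morph f : a b / a - b} ->
  (forall a, B a -> B (f a)) ->
  (forall U, absconvex_nbhs U ->
     exists2 V, absconvex_nbhs V & forall z, V z -> U (f z)) ->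
  closed [set a | B a /\ J (f a)].
Proof.
move=> fB fB' fc a ha.
have Ba : B a by apply: generated_closed; apply: closureS ha => b [].
split=> //; apply: (closed_rad hB generated_closed).
move=> W /nbhs_absconvex[U aU UW]; have [V aV hV] := fc U aU.
have [b [[Bb Jb] /= hb]] := ha _ (nbhs_gauge_le a aV ltr01).
exists (f b); split=> //; apply: UW; rewrite -fB; apply: hV.
exact/gauge_le_mem.
Qed.

(** Linear conditions on the class of [a] define closed sets, because the radical is
    closed; this is what extends identities from [g] to the algebra it generates. *)
Lemma closed_lkernel p r : closed [set a | B a /\ p * pi a * r = 0].
Proof.
have -> : [set a | B a /\ p * pi a * r = 0] =
    [set a | B a /\ J (quot_lift p * a * quot_lift r)].
  apply/seteqP; split=> a [Ba h]; split=> //.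
    apply/mk_eq0; first by do 2?[apply: (subalgM hB) => //]; apply: lift_in.
    rewrite !quot_mkM ?quot_liftK //; first exact: lift_in.
      by apply: (subalgM hB) => //; apply: lift_in.
    exact: lift_in.
  rewrite -[p]quot_liftK -[r]quot_liftK -!quot_mkM //; try exact: lift_in.
    apply/mk_eq0 => //.
    by do 2?[apply: (subalgM hB) => //]; apply: lift_in.
  by apply: (subalgM hB) => //; apply: lift_in.
apply: closed_rad_preimage.
- by move=> a b; rewrite mulrBr mulrBl.
- by move=> a Ba; do 2?[apply: (subalgM hB) => //]; apply: lift_in.
- by move=> U aU; apply: mulLR_small.
Qed.

Lemma closed_commutant (c : Q) : closed [set a | B a /\ brk c (pi a) = 0].
Proof.
pose x := quot_lift c; have Bx : B x by exact: lift_in.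
have -> : [set a | B a /\ brk c (pi a) = 0] =
    [set a | B a /\ J (x * a - a * x)].
  have h a : B a -> brk c (pi a) = pi (x * a - a * x).
    move=> Ba; rewrite -[in LHS](quot_liftK c) -quot_mk_brk //.
  have hx a : B a -> B (x * a - a * x).
    by move=> Ba; apply: (subalgB hB); apply: (subalgM hB).
  apply/seteqP; split=> a [Ba]; rewrite ?h // => e; split=> //.
    by apply/mk_eq0 => //; apply: hx.
  by rewrite h //; apply/mk_eq0 => //; apply: hx.
apply: closed_rad_preimage.
- move=> a b; rewrite mulrBr mulrBl !opprB addrACA [- (x * b) + _]addrC.
  by rewrite !addrA; congr (_ + _); rewrite -!addrA; congr (_ + _); rewrite addrC.
- by move=> a Ba; apply: (subalgB hB); apply: (subalgM hB).
- move=> U aU; have h2 : 0 < 2^-1 :> R[i] by rewrite invr_gt0.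
  have [V aV hV] := mulLR_small x 1 (absconvex_gauge_le aU h2).
  have [W aW hW] := mulLR_small 1 x (absconvex_gauge_le aU h2).
  have [X aX hX] := absconvex_base (filterI aV.1 aW.1).
  exists X => // z /hX[/hV /= hz1 /hW /= hz2].
  rewrite mulr1 in hz1; rewrite mul1r in hz2.
  apply/gauge_le_mem => //; rewrite [1]splitr mul1r.
  by apply: gauge_leD => //; apply: gauge_leN.
Qed.

End GeneratedAlgebra.
Arguments generated_closed {R A} g.
Arguments closed_lkernel {R A g} p r.
Arguments closed_commutant {R A g} c.

Section RadicalQuotientOfGenerated.
Variables (R : realType) (A : ciaType R[i]) (g : set A).
Implicit Types (a b x y z : A).
Local Notation B := (closed_generated_algebra g).
Local Notation J := (jacobson_rad B).
Local Notation Q := (rad_quotient (generated g)).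
Local Notation pi := (@quot_mk R A (generated g)).
Local Notation hB := (generated_subalgebra g).
Local Notation cB := (generated_closed g).
Implicit Types (c d p q r u : Q).

(** The image of [g] in the quotient. *)
Definition quot_gen : set Q := [set pi x | x in g].

(** Induction over the quotient as a closed algebra generated by the image of [g]. *)
Lemma quot_gen_rect (P : set Q) : subspace P -> P 1 ->
  (forall p q, P p -> P q -> P (p * q)) -> quot_gen `<=` P ->
  closed [set a | B a /\ P (pi a)] -> forall q, P q.
Proof.
move=> sP P1 PM gP cP q; rewrite -[q]quot_liftK.
suff : B `<=` [set a | B a /\ P (pi a)] by move=> /(_ _ (lift_in q))[].
move=> a; apply; split; last by move=> x gx; split; [exact: generated_sub|apply: gP; exists x].
split=> //; split.
- split; first by split; [exact: subalg0 hB|rewrite quot_mk0; case: sP].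
  move=> l x y [Bx Px] [By Py].
  have Blx : B (l *: x) by apply: (subalgZ hB).
  split; first exact: (subalgD hB).
  by rewrite quot_mkD // quot_mkZ //; case: sP => _; apply.
- by split; [exact: subalg1 hB|rewrite quot_mk1].
- move=> x y [Bx Px] [By Py]; split; first exact: (subalgM hB).
  by rewrite quot_mkM //; apply: PM.
Qed.

Lemma closed_forall (I : Type) (P : I -> set A) :
  (forall i, closed [set a | B a /\ P i a]) ->
  closed [set a | B a /\ forall i, P i a].
Proof.
move=> cP a ha; split; first by apply: (generated_closed g); apply: closureS ha => b [].
move=> i; suff [] : [set a | B a /\ P i a] a by [].
by apply: cP; apply: closureS ha => b [Bb hb].
Qed.

Lemma quot_central c : (forall x : Q, quot_gen x -> brk c x = 0) ->
  forall q, GRing.comm c q.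
Proof.
move=> hc q; apply: brk_eq0; move: q; apply: quot_gen_rect.
- split; first by rewrite /brk mulr0 mul0r subrr.
  by move=> l p q hp hq; rewrite brk_linearr hp hq scaler0 addr0.
- by rewrite /brk mulr1 mul1r subrr.
- by move=> p q hp hq; rewrite brkMr hp hq mul0r mulr0 addr0.
- exact: hc.
- exact: closed_commutant.
Qed.

(** The left ideals annihilated by words in a [g]-stable subspace are two-sided. *)
Lemma rkill_ideal (N : set Q) : (forall c (x : Q), N c -> quot_gen x -> N (brk c x)) ->
  subspace N -> forall i q u, rkill N i u -> rkill N i (u * q).
Proof.
move=> hN sN i; suff H : forall q u, rkill N i u -> rkill N i (u * q).
  by move=> q u; apply: H.
apply: quot_gen_rect.
- split; first by move=> u _; rewrite mulr0; case: (subspace_rkill N i).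
  move=> l p q hp hq u hu; rewrite mulrDr -scalerAr.
  by case: (subspace_rkill N i) => _; apply; [exact: hp|exact: hq].
- by move=> u; rewrite mulr1.
- by move=> p q hp hq u hu; rewrite mulrA; apply/hq/hp.
- move=> x gx u; apply: rkill_normalize => h Nh.
  by rewrite brkN -scaleN1r; apply: subspaceZ => //; apply: hN.
- apply: closed_forall => u.
  have [hu|hu] := pselect (rkill N i u); last first.
    suff -> : [set a | B a /\ (rkill N i u -> rkill N i (u * pi a))] = B.
      exact: cB.
    by apply/seteqP; split=> a; [case|].
  pose W := {s : seq Q | size s = i /\ forall p, p \in s -> N p}.
  suff -> : [set a | B a /\ (rkill N i u -> rkill N i (u * pi a))] =
      [set a | B a /\ forall s : W, u * pi a * (\prod_(x <- sval s) x) = 0].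
    by apply: closed_forall => s; apply: closed_lkernel.
  apply/seteqP; split=> a [Ba h]; split=> //.
    by move=> [s [ss hs]]; move: (h hu) => /rkillP; apply.
  move=> _; apply/rkillP => s ss hs.
  exact: (h (exist _ s (conj ss hs))).
Qed.

(** For [c] in [N], each factor [q * c] moves one step down the chain of ideals
    [rkill N i], so [(q * c) ^ m = 0] for all [q]; hence [c] lifts to the radical. *)
Lemma nil_ideal_eq0 (N : set Q) : subspace N ->
  (forall c (x : Q), N c -> quot_gen x -> N (brk c x)) ->
  (exists m, rkill N m 1) -> forall c, N c -> c = 0.
Proof.
move=> sN hN [m hm] c Nc.
have h i u q : rkill N i.+1 u -> rkill N i (u * (q * c)).
  by move=> hu; rewrite mulrA; apply: (rkill_ideal hN sN q hu).
have pw q : (q * c) ^+ m = 0.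
  suff H k u : (k <= m)%N -> rkill N k u -> u * (q * c) ^+ k = 0.
    by have := H m 1 (leqnn m) hm; rewrite mul1r.
  elim: k u => [|k IH] u km hu; first by rewrite expr0 mulr1.
  by rewrite exprS mulrA; apply: IH (ltnW km) (h _ _ _ hu).
rewrite -[c]quot_liftK; apply/mk_eq0; first exact: lift_in.
apply: (rad_of_powers hB); first exact: lift_in.
move=> b Bb; exists m; apply: (rad_unit1 hB).
have Bbc : B (b * quot_lift c) by apply: (subalgM hB) => //; apply: lift_in.
apply/mk_eq0; first exact: (subalgX hB).
rewrite quot_mkX // quot_mkM ?quot_liftK //; exact: lift_in.
Qed.

(** Quasinilpotence in the quotient, phrased by lifting the powers of [c] to a sequence in
    the algebra, as the quotient carries no topology here. *)
Definition quasinil c : Prop := exists w : nat -> A,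
  [/\ forall n, B (w n), forall n, pi (w n) = c ^+ n & superexp w].

(** If [c] lifts to [c'], then [(b c') ^ n] agrees modulo the radical with [b ^ n w n],
    which tends to [0]; so [1 - (b c') ^ n] is invertible for large [n]. *)
Lemma quasinil_central_eq0 c : (forall x : Q, quot_gen x -> brk c x = 0) ->
  quasinil c -> c = 0.
Proof.
move=> hc [w [Bw wc sw]]; have cc := quot_central hc.
rewrite -[c]quot_liftK; apply/mk_eq0; first exact: lift_in.
have Bc := lift_in c.
apply: (rad_of_powers hB) => // b Bb.
have [U aU hU] := small_powers_vanish A.
have h2 : 0 < 2^-1 :> R[i] by rewrite invr_gt0.
have [n hn] := vanishing_gauge_le (superexp_vanishing b sw) aU h2.
have Bbn : B (b ^+ n * w n) by apply: (subalgM hB) => //; apply: (subalgX hB).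
have Bbc : B ((b * quot_lift c) ^+ n) by apply: (subalgX hB); apply: (subalgM hB).
exists n.
have -> : 1 - (b * quot_lift c) ^+ n =
    1 - b ^+ n * w n - ((b * quot_lift c) ^+ n - b ^+ n * w n).
  by rewrite opprB addrA subrK.
apply: (rad_unit hB).
  by apply: (vanishing_unit_in hB cB) => //; apply/hU/hn.
apply/mk_eq0; first exact: (subalgB hB).
have Bb' : B (b ^+ n) by apply: (subalgX hB).
have Bwn := Bw n.
rewrite quot_mkB // quot_mkX ?quot_mkM //; last exact: (subalgM hB).
rewrite quot_liftK wc quot_mkX // exprMn_comm ?subrr //.
by apply: commr_sym; apply: cc.
Qed.

Lemma iter_quot_brk x y n : B x -> B y ->
  B (iter n (brk x) y) /\ pi (iter n (brk x) y) = iter n (brk (pi x)) (pi y).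
Proof.
move=> Bx By; elim: n => [//|n [IH1 IH2]]; rewrite !iterS.
split; first by apply: (subalgB hB); apply: (subalgM hB).
by rewrite quot_mk_brk // IH2.
Qed.

Lemma quasinil_brk p q : brk p (brk p q) = 0 -> quasinil (brk p q).
Proof.
move=> h; set x := quot_lift p; set y := quot_lift q.
have Bx : B x := lift_in p; have By : B y := lift_in q.
exists (fun n => (n`!%:R : R[i])^-1 *: iter n (brk x) (y ^+ n)); split.
- move=> n; apply: (subalgZ hB).
  by case: (iter_quot_brk n Bx (subalgX hB n By)).
- move=> n; have [Bi piE] := iter_quot_brk n Bx (subalgX hB n By).
  rewrite quot_mkZ // piE quot_mkX // !quot_liftK iter_brk_expr //.
  by rewrite scalerA mulVf ?scale1r // pnatr_eq0 -lt0n fact_gt0.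
- exact: superexp_brk.
Qed.

Lemma quasinil_linear (l : R[i]) c d : GRing.comm c d -> quasinil c ->
  quasinil d -> quasinil (l *: c + d).
Proof.
move=> cd [v [Bv vc sv]] [w [Bw wd sw]].
pose v' n := l ^+ n *: v n.
have Bv' n : B (v' n) by apply: (subalgZ hB).
have sv' : superexp v'.
  move=> r r0; have [l0|l0] := eqVneq l 0.
    move=> U aU; have [k hk] := gauge_le_ex (v 0%N) aU; exists k => -[|n].
      by rewrite /v' !expr0 !scale1r.
    rewrite /v' l0 [0 ^+ _]exprS mul0r scale0r scaler0.
    by apply: gauge_le_le (gauge_le0 aU) => //; case: hk.
  have rl : 0 < r * `|l| by rewrite mulr_gt0 // normr_gt0.
  move=> U aU; have [k hk] := sv _ rl U aU; exists k => n.
  rewrite /v' scalerA -exprMn.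
  have -> : (r * l) ^+ n *: v n = (l / `|l|) ^+ n *: ((r * `|l|) ^+ n *: v n).
    rewrite scalerA -exprMn; congr (_ ^+ _ *: _).
    by rewrite mulrCA divfK // normr_eq0.
  apply: gauge_le_le (gauge_leZ _ aU (hk n)) => //.
  by rewrite normrX normrM normfV normr_id divff ?normr_eq0 // expr1n mul1r.
exists (fun n => \sum_(i < n.+1) (v' (n - i)%N * w i) *+ 'C(n, i)); split.
- move=> n; apply: (subalg_sum hB) => i _; rewrite -scaler_nat.
  by apply: (subalgZ hB); apply: (subalgM hB).
- move=> n; rewrite exprDn_comm; last by rewrite /GRing.comm -scalerAl cd scalerAr.
  rewrite quot_mk_sum; last first.
    by move=> i; rewrite -scaler_nat; apply: (subalgZ hB); apply: (subalgM hB).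
  apply: eq_bigr => i _; have Bvw : B (v' (n - i)%N * w i) by apply: (subalgM hB).
  rewrite -scaler_nat quot_mkZ // scaler_nat; congr (_ *+ _).
  have Bvi : B (v (n - i)%N) by [].
  have piv : pi (v' (n - i)%N) = l ^+ (n - i) *: c ^+ (n - i).
    by rewrite -vc -quot_mkZ.
  by rewrite quot_mkM; [rewrite piv wd exprZn|exact: Bv'|exact: Bw].
- exact: superexp_conv.
Qed.

(** If [u] is an eigenvector of [ad q] for the eigenvalue [kap], of large modulus, then [u]
    lifts to an element congruent modulo the radical to [kap ^ -n (ad x) ^ n y], where
    [x] and [y] lift [q] and [u]; this tends to [0], so [u] is zero. *)
Lemma quot_brk_bounded q (mu : R[i]) : mu != 0 ->
  exists k, forall u, brk u q = (k%:R * mu) *: u -> u = 0.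
Proof.
move=> mu0; set x := quot_lift q; have Bx : B x := lift_in q.
have [C C0 hC] := iter_brk_vanishing x.
have nmu : 0 < `|mu| by rewrite normr_gt0.
have C1 : 0 <= C / `|mu| + 1 by rewrite addr_ge0 ?divr_ge0.
have [k hk] := complex_nat_bound C1.
exists k => u hu; set y := quot_lift u; have By : B y := lift_in u.
pose kap := - (k%:R * mu).
have kC : C <= `|kap|.
  rewrite normrN normrM normr_nat -ler_pdivrMr //.
  by apply: le_trans hk; rewrite lerDl.
have kap0 : kap != 0.
  rewrite oppr_eq0 mulf_neq0 //; apply/eqP => k0; move: hk.
  by rewrite k0 lt_geF // ltr_wpDl // divr_ge0.
have hit n : iter n (brk q) u = kap ^+ n *: u.
  elim: n => [|n IH]; first by rewrite expr0 scale1r.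
  by rewrite iterS IH brkZr brkN hu -scaleNr scalerA -/kap exprSr.
rewrite -[u]quot_liftK; apply/mk_eq0 => //.
apply: (closed_vanishing (closed_rad hB cB) (hC kap y kC)) => n.
have [Bi piE] := iter_quot_brk n Bx By.
have Bi' : B (kap ^- n *: iter n (brk x) y) by apply: (subalgZ hB).
apply/mk_eq0; first exact: (subalgB hB).
rewrite quot_mkB // quot_mkZ // piE !quot_liftK hit scalerA mulVf ?expf_neq0 //.
by rewrite scale1r subrr.
Qed.

End RadicalQuotientOfGenerated.
Arguments quot_gen {R A} g _.

(** * Solvable ideals *)

Section SolvableIdeals.
Variables (R : realType) (A : ciaType R[i]) (g : set A).
Hypothesis hg : lie_subalgebra g.
Implicit Types (a b x y z : A) (X Y j : set A).
Local Notation B := (closed_generated_algebra g).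
Local Notation J := (jacobson_rad B).
Local Notation pi := (@quot_mk R A (generated g)).
Local Notation hB := (generated_subalgebra g).

Lemma linear_span_min X Y : linear_subspace Y -> X `<=` Y -> linear_span X `<=` Y.
Proof. by move=> sY XY x; apply. Qed.

Lemma linear_span_subspace X : linear_subspace (linear_span X).
Proof.
split; first by move=> Y [[]].
move=> l x y hx hy Y hY; case: (hY) => -[_ h] _.
by apply: h; [exact: hx|exact: hy].
Qed.

Lemma sub_linear_span X : X `<=` linear_span X.
Proof. by move=> x Xx Y [_]; apply. Qed.

Lemma lie_bracket_ideal j : lie_ideal g j -> lie_ideal g (lie_bracket j j).
Proof.
move=> [sj jg ij]; split; first exact: linear_span_subspace.
  apply: linear_span_min; first by case: hg.
  by move=> _ [x jx [y jy <-]]; case: hg => _; apply; apply: jg.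
move=> x y hx gy; have [s0 sl] := linear_span_subspace [set lie x y | x in j & y in j].
move: x hx; apply: linear_span_min.
  split; first by rewrite /lie mul0r mulr0 subrr.
  move=> l x x' hx hx'; rewrite /= -[lie _ _]/(brk (l *: x + x') y) brk_linear.
  exact: sl.
move=> _ [x jx [x' jx' <-]] /=; rewrite -[lie (lie x x') y]/(brk (brk x x') y) jacobi.
rewrite -[brk (brk x y) x']scale1r; apply: sl; apply: sub_linear_span.
  by exists (brk x y); [exact: ij|exists x'].
by exists x => //; exists (brk x' y) => //; apply: ij.
Qed.

(** In the quotient, the image of a finite-dimensional solvable ideal [j] commutes with
    the image of [g].  The induction is on the derived length; finite dimension is
    expressed by a fixed spanning sequence of an ambient space, so that it passes to the
    derived ideal at once. *)
Lemma solvable_ideal_quotient n j (s : seq A) : lie_ideal g j ->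
  j `<=` linear_span [set` s] -> (forall x, x \in s -> B x) ->
  derived_series j n = [set 0] ->
  forall x y, j x -> g y -> brk (pi x) (pi y) = 0.
Proof.
elim: n j => [|n IH] j hj js sB hn x y jx gy.
  have -> : x = 0 by have : [set 0] x by rewrite -hn.
  by rewrite quot_mk0 brk0.
have [sj jg ij] := hj.
have gB : g `<=` B := @generated_sub R A g.
have jB : j `<=` B by move=> z /jg/gB.
have hG : subspace (quot_gen g).
  case: hg => -[g0 gl] _; split; first by exists 0.
  move=> l _ _ [a ga <-] [b gb <-]; exists (l *: a + b); first exact: gl.
  rewrite quot_mkD ?quot_mkZ //; try exact: gB.
  by apply: (subalgZ hB); apply: gB.
have hj' : forall a b, j a -> j b -> forall c, g c ->
    brk (pi (lie a b)) (pi c) = 0.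
  move=> a b ja jb c gc; apply: (IH (lie_bracket j j)) => //.
  - exact: lie_bracket_ideal.
  - apply: subset_trans js; apply: linear_span_min => //.
    by move=> _ [a' ja' [b' jb' <-]]; apply/ij/jg.
  - by rewrite -hn /derived_series iterSr.
  - by apply: sub_linear_span; exists a => //; exists b.
have ab0 a b : j a -> j b -> GRing.comm (pi a) (pi b).
  move=> ja jb; apply: brk_eq0.
  have e : brk (pi a) (pi b) = pi (lie a b).
    by rewrite -quot_mk_brk; [|exact: jB|exact: jB].
  apply: (@quasinil_central_eq0 R A g).
    by move=> _ [c gc <-]; rewrite e; apply: hj'.
  apply: quasinil_brk; rewrite brkN e; apply/eqP; rewrite oppr_eq0; apply/eqP.
  by apply: hj' => //; apply: jg.
apply: (@abelian_ideal_central _ _ _ (quot_gen g) (@quasinil R A g) hG _ _ _ _ _ _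
  [set pi x | x in j]) => //.
- move=> _ _ [a ga <-] [b gb <-]; rewrite -quot_mk_brk; try exact: gB.
  by exists (lie a b) => //; case: hg => _; apply.
- exact: quasinil_central_eq0.
- exact: quasinil_brk.
- exact: quasinil_linear.
- exact: quot_brk_bounded.
- exact: nil_ideal_eq0.
- split; first by exists 0 => //; case: sj.
  move=> l _ _ [a ja <-] [b jb <-]; exists (l *: a + b); first by apply: sj.2.
  rewrite quot_mkD ?quot_mkZ //; try exact: jB.
  by apply: (subalgZ hB); apply: jB.
- pose e (i : 'I_(size s)) := pi (nth 0 s i).
  exists (size s), e => _ [a ja <-].
  suff [] : B a /\ range (comb e) (pi a) by [].
  have [r0 rl] := subspace_range e.
  apply: (linear_span_min (Y := [set a | B a /\ range (comb e) (pi a)]) _ _ (js a ja)).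
    split; first by split; [exact: subalg0 hB|exact: r0].
    move=> l x1 x2 [B1 h1] [B2 h2]; have Bl : B (l *: x1) by apply: (subalgZ hB).
    split; first exact: (subalgD hB).
    by rewrite quot_mkD // quot_mkZ //; apply: rl.
  move=> z /= zs; split; first exact: sB.
  have iz : (index z s < size s)%N by rewrite index_mem.
  exists (delta_mx 0 (Ordinal iz)) => //.
  rewrite /comb (bigD1 (Ordinal iz)) //= mxE !eqxx scale1r big1 ?addr0.
    by rewrite /e /= nth_index.
  by move=> i ni; rewrite mxE (negbTE ni) andbF scale0r.
- move=> _ _ [a ja <-] [b gb <-]; exists (lie a b); first exact: ij.
  by rewrite quot_mk_brk //; [exact: jB|exact: gB].
- by move=> _ _ [a ja <-] [b jb <-]; apply: ab0.
- by exists x.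
- by exists y.
Qed.

Lemma rad_quasinilpotent : J `<=` quasinilpotents A.
Proof.
move=> a Ja.
have ul (l : R[i]) : 1 - l *: a \is a GRing.unit.
  have [_ [y _ [h1 h2]]] : unit_in B (1 - l *: a).
    by apply: (rad_unit1 hB); apply: (radZ hB).
  by apply/unitrP; exists y.
apply/seteqP; split=> l /=; last first.
  move=> ->; rewrite /spectrum /= scale0r sub0r unitrN => ua.
  have [r r0 hr] := powers_exp_bounded a^-1.
  have hv : vanishing (fun n => ((2 / r) *: a) ^+ n).
    by apply: powers_vanish => m _; rewrite scalerA.
  have ha : exp_bounded (2 / r) (fun n => a ^+ n).
    move=> U aU; have [c hc] := vanishing_bounded hv U aU.
    by exists c => n; rewrite -exprZn.
  have h2 : exp_bounded 2 (fun n => (1 : A) ^+ n).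
    have := exp_bounded_mul ha hr; rewrite divfK ?gt_eqF //.
    congr exp_bounded; apply/funext => n.
    by rewrite exprVn divrr ?unitrX // expr1n.
  have := vanishing_unit (exp_bounded2_vanishing h2).
  by rewrite subrr unitr0.
move=> nu; apply/eqP/negPn/negP => l0; apply: nu.
have -> : l%:A - a = l *: (1 - l^-1 *: a).
  by rewrite scalerBr scalerA divff // scale1r.
by rewrite scaler_unit ?unitfE.
Qed.

End SolvableIdeals.

Theorem theorem4p3 (R : realType) (A : ciaType R[i]) (g : set A) :
  fc_complete A ->
  lie_subalgebra g ->
  forall j : set A,
    lie_ideal g j -> finite_dimensional j -> solvable_lie j ->
    (lie_bracket j g `<=` jacobson_rad (closed_generated_algebra g))%classic /\
    (jacobson_rad (closed_generated_algebra g) `<=` quasinilpotents A)%classic.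
Proof.
move=> _ hg j hj [s js] [n hn]; split; last exact: rad_quasinilpotent.
have [sj jg ij] := hj.
apply: linear_span_min.
  split; first exact: (rad0 (generated_subalgebra g)).
  move=> l x y Jx Jy; apply: (radD (generated_subalgebra g)) => //.
  exact: (radZ (generated_subalgebra g)).
move=> _ [x jx [y gy <-]].
have Bx : closed_generated_algebra g x by apply: generated_sub; apply: jg.
have By : closed_generated_algebra g y by apply: generated_sub.
apply/mk_eq0.
  by apply: (subalgB (generated_subalgebra g)); apply: (subalgM (generated_subalgebra g)).
rewrite quot_mk_brk //.
apply: (solvable_ideal_quotient hg (s := s) hj _ _ hn) => //.
  by rewrite js => z.
by move=> z zs; apply: generated_sub; apply: jg; rewrite js; apply: sub_linear_span.
Qed.
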